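(* Let $A$ and $B$ be C$^*$-algebras. Every 2-contractive triple homomorphism $S:A\to B$ is a TRO homomorphism.
   Context: A linear map $S:A\to B$ between C$^*$-algebras is a triple homomorphism if $S(\{a,b,c\})=\{S(a),S(b),S(c)\}$ for all $a,b,c\in A$, where $\{a,b,c\}=\frac12(ab^*c+cb^*a)$; it is a TRO homomorphism if $S(ab^*c)=S(a)S(b)^*S(c)$ for all $a,b,c\in A$. $S$ is 2-contractive if the amplification $S_2:M_2(A)\to M_2(B)$, $S_2((a_{i,j}))=(S(a_{i,j}))$, is contractive. *)

(* Defs.v *)
From HB Require Import structures.
From mathcomp Require Import all_boot all_order all_algebra.
From mathcomp Require Import all_classical all_reals all_analysis.
From mathcomp Require Import complex.

Set Implicit Arguments.
Unset Strict Implicit.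
Unset Printing Implicit Defensive.

Import Order.TTheory GRing.Theory Num.Theory.
Import numFieldNormedType.Exports.

Local Open Scope ring_scope.
Local Open Scope complex_scope.

(* C*-algebras need not have a unit (and may be zero), so the product cannot
   come from the MathComp ring hierarchy.  The norm takes values in R[i], in
   which [x <= y] says that y - x is real and nonnegative. *)
HB.mixin Record CompleteNormedModule_isCStarAlgebra (R : realType) A
    & CompleteNormedModule R[i] A := {
  cmul : A -> A -> A ;
  cstar : A -> A ;
  cmulA : forall x y z : A, cmul x (cmul y z) = cmul (cmul x y) z ;
  cmulDl : forall x y z : A, cmul (x + y) z = cmul x z + cmul y z ;
  cmulDr : forall x y z : A, cmul x (y + z) = cmul x y + cmul x z ;
  cmulZl : forall (k : R[i]) (x y : A), cmul (k *: x) y = k *: cmul x y ;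
  cmulZr : forall (k : R[i]) (x y : A), cmul x (k *: y) = k *: cmul x y ;
  cstarD : forall x y : A, cstar (x + y) = cstar x + cstar y ;
  cstarZ : forall (k : R[i]) (x : A), cstar (k *: x) = conjc k *: cstar x ;
  cstarM : forall x y : A, cstar (cmul x y) = cmul (cstar y) (cstar x) ;
  cstarK : forall x : A, cstar (cstar x) = x ;
  norm_cmul_le : forall x y : A, `|cmul x y| <= `|x| * `|y| ;
  norm_cstar_mul : forall x : A, `|cmul (cstar x) x| = `|x| ^+ 2 }.

#[short(type="cstarAlgType")]
HB.structure Definition CStarAlgebra (R : realType) :=
  {A of CompleteNormedModule R[i] A & CompleteNormedModule_isCStarAlgebra R A}.

Declare Scope cstar_scope.
Delimit Scope cstar_scope with cstar.
Reserved Notation "x ^**" (at level 1, left associativity, format "x ^**").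
Notation "x ** y" := (cmul x y)
  (at level 40, left associativity) : cstar_scope.
Notation "x ^**" := (cstar x) : cstar_scope.
Local Open Scope cstar_scope.

Definition triple (R : realType) (A : cstarAlgType R) (a b c : A) : A :=
  2^-1 *: (a ** b^** ** c + c ** b^** ** a).

Definition triple_hom (R : realType) (A B : cstarAlgType R) (S : A -> B) :=
  forall a b c : A, S (triple a b c) = triple (S a) (S b) (S c).

Definition tro_hom (R : realType) (A B : cstarAlgType R) (S : A -> B) :=
  forall a b c : A, S (a ** b^** ** c) = S a ** (S b)^** ** S c.

Definition mx2_mul (R : realType) (A : cstarAlgType R) (x y : 'M[A]_2) :
    'M[A]_2 :=
  \matrix_(i, j) \sum_(k < 2) x i k ** y k j.

Definition mx2_star (R : realType) (A : cstarAlgType R) (x : 'M[A]_2) :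
    'M[A]_2 :=
  \matrix_(i, j) (x j i)^**.

(* The C*-algebra M is M_2(A): phi is a *-isomorphism onto M from the
   *-algebra of 2 x 2 matrices over A.  The C*-norm on M_2(A) is unique, so
   x |-> `|phi x| does not depend on M and phi. *)
Definition is_M2 (R : realType) (A M : cstarAlgType R)
    (phi : 'M[A]_2 -> M) : Prop :=
  [/\ bijective phi,
      forall x y, phi (x + y) = phi x + phi y,
      forall (k : R[i]) x, phi (map_mx ( *:%R k) x) = k *: phi x,
      forall x y, phi (mx2_mul x y) = phi x ** phi y &
      forall x, phi (mx2_star x) = (phi x)^**].

(* M_2(A) and M_2(B) always carry a C*-norm and it is unique, so the
   existential quantifiers only give names to these two C*-algebras. *)
Definition two_contractive (R : realType) (A B : cstarAlgType R)
    (S : A -> B) : Prop :=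
  exists (MA MB : cstarAlgType R) (phi : 'M[A]_2 -> MA) (psi : 'M[B]_2 -> MB),
    [/\ is_M2 phi, is_M2 psi &
        forall x : 'M[A]_2, `|psi (map_mx S x)| <= `|phi x|].

(* Main.v *)
Require Import Defs.
From mathcomp Require Import all_boot all_order all_algebra.
From mathcomp Require Import all_classical all_reals all_analysis.
From mathcomp Require Import complex.
From mathcomp Require Import cyclic separable cyclotomic.
From mathcomp Require Import ring lra.

Set Implicit Arguments.
Unset Strict Implicit.
Unset Printing Implicit Defensive.

Import Order.TTheory GRing.Theory Num.Theory.

Local Open Scope ring_scope.
Local Open Scope complex_scope.
Local Open Scope cstar_scope.

(** Write J x = S x (S e)^** for an approximate unit e of the elements at hand.
    Up to small errors J is a Jordan *-homomorphism: S e (S e)^** acts as a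
    unit on each S x because left multiplication L by S e (S e)^** and right
    multiplication Q by (S e)^** S e satisfy L + Q = 2 and L Q = 1 there, so
    that (L - 1)^2 = 0, and the C*-identity gives L = 1.  It suffices that J be
    multiplicative.

    For a unital Jordan homomorphism contractive on rows, a Schwarz inequality
    makes the self-adjoint defect k(x) = J x (J x)^** - J (x x^** ) nonpositive,
    while the Jordan identity reads k(x) + k(x^** ) = 0, so that k = 0.  The
    argument is run here on norms alone.  The row with entries
    e (1 - t x x^** / 2) and sqrt t e x has norm 1 + O(t^2), and the square of
    its image is S e (S e)^** + t k(x) up to O(t^2); with the same bound for
    x^** this gives

      |S e (S e)^** + t k| <= 1 + O(t^2) and |S e (S e)^** - t k| <= 1 + O(t^2).

    [rigidity_bound] turns these two bounds into k = 0: self-adjointness extends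
    them to all S e (S e)^** + z t k with |z| = 1, and the average of
    w^-1 (1 + w t k)^N k over roots of unity w isolates N t k^2, which must stay
    bounded as N grows and t = T / N.  Polarization then gives the
    multiplicativity of J.

    The norm used on A is that of the corner x E11 in M_2(A), which is the
    quantity that 2-contractivity controls, and likewise on B.  In it, columns
    give |y|^2 <= |y^** y + z^** z|, the form of monotonicity from which a
    common approximate unit of three self-adjoint elements is built
    ([common_unit]).  The approximate unit of one self-adjoint h comes from the
    resolvent of i tau h ([approx_unit]).  Limits along approximate units are
    handled as equalities of bounded sequences modulo null sequences
    ([seqv]). *)

(** * Linear identities in a module *)

Inductive lexp (K : Type) : Type :=
  | LAtom of nat
  | LZero
  | LAdd of lexp K & lexp K
  | LOpp of lexp K
  | LScale of K & lexp K.
Arguments LAtom {K}.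
Arguments LZero {K}.

Section LinearNormalForm.
Context {K : comNzRingType} {V : lmodType K}.

Fixpoint leval (env : seq V) (e : lexp K) : V :=
  match e with
  | LAtom n => nth 0 env n
  | LZero => 0
  | LAdd a b => leval env a + leval env b
  | LOpp a => - leval env a
  | LScale c a => c *: leval env a
  end.

Fixpoint lcoef (e : lexp K) (i : nat) : K :=
  match e with
  | LAtom n => if eqn n i then 1 else 0
  | LZero => 0
  | LAdd a b => lcoef a i + lcoef b i
  | LOpp a => - lcoef a i
  | LScale c a => c * lcoef a i
  end.

Lemma leval_sum (env : seq V) (e : lexp K) :
  leval env e = \sum_(i < size env) lcoef e i *: env`_i.
Proof.
elim: e => [n||a IHa b IHb|a IHa|c a IHa] /=.
- have [lt_n|ge_n] := ltnP n (size env); last first.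
    rewrite nth_default // big1 // => i _.
    case: eqnP => [ni|_]; last by rewrite scale0r.
    by move: (ltn_ord i); rewrite -ni ltnNge ge_n.
  rewrite (bigD1 (Ordinal lt_n)) //= big1 ?addr0.
    by case: eqnP => // _; rewrite scale1r.
  move=> i /eqP ni; case: eqnP => [eq_ni|_]; last by rewrite scale0r.
  by case: ni; apply/val_inj.
- by rewrite big1 // => i _; rewrite scale0r.
- by rewrite IHa IHb -big_split /=; apply: eq_bigr => i _; rewrite scalerDl.
- by rewrite IHa -sumrN; apply: eq_bigr => i _; rewrite scaleNr.
- by rewrite IHa scaler_sumr; apply: eq_bigr => i _; rewrite scalerA.
Qed.

Lemma leval_eq (env : seq V) (a b : lexp K) :
  foldr (fun i P => lcoef a i = lcoef b i /\ P) True (iota 0 (size env)) ->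
  leval env a = leval env b.
Proof.
move=> ab; rewrite !leval_sum; apply: eq_bigr => i _; congr (_ *: _).
have : (i : nat) \in iota 0 (size env) by rewrite mem_iota ltn_ord.
elim: (iota 0 _) ab => //= j s IH [eq_j /IH{}IH].
by rewrite in_cons => /orP[/eqP-> //|/IH].
Qed.

End LinearNormalForm.

Ltac add_atom x l :=
  match l with
  | nil => constr:(cons x nil)
  | cons x _ => l
  | cons ?y ?t => let t' := add_atom x t in constr:(cons y t')
  end.
Ltac atom_index x l :=
  match l with
  | cons x _ => constr:(O)
  | cons _ ?t => let n := atom_index x t in constr:(S n)
  end.
Ltac lin_atoms t l :=
  lazymatch t with
  | (?a + ?b)%R => let l' := lin_atoms a l in lin_atoms b l'
  | (- ?a)%R => lin_atoms a l
  | (_ *: ?a)%R => lin_atoms a l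
  | 0%R => l
  | _ => add_atom t l
  end.
Ltac lin_reify K t l :=
  lazymatch t with
  | (?a + ?b)%R =>
      let a' := lin_reify K a l in let b' := lin_reify K b l in
      constr:(@LAdd K a' b')
  | (- ?a)%R => let a' := lin_reify K a l in constr:(@LOpp K a')
  | (?c *: ?a)%R => let a' := lin_reify K a l in constr:(@LScale K c a')
  | 0%R => constr:(@LZero K)
  | _ => let n := atom_index t l in constr:(@LAtom K n)
  end.
(** Compares the coefficients of each atom on both sides; equalities and
    non-vanishing conditions in K that [field] cannot settle are left open. *)
Ltac lin K :=
  lazymatch goal with
  | |- @eq ?V ?a ?b =>
      let l := lin_atoms a (@nil V) in
      let l := lin_atoms b l in
      let ea := lin_reify K a l in
      let eb := lin_reify K b l in
      refine (@leval_eq _ _ l ea eb _);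
      cbv [lcoef foldr iota size eqn]; repeat split;
      try reflexivity; try ring; try (field; try done)
  end.

Lemma conjcM (R : realType) (a b : R[i]) : conjc (a * b) = conjc a * conjc b.
Proof. exact: rmorphM. Qed.

Section StarAlgebra.
Context {R : realType} {A : cstarAlgType R}.
Implicit Types x y z : A.

Lemma cmul0l x : 0 ** x = 0.
Proof. by rewrite -(scale0r (0 : A)) cmulZl !scale0r. Qed.

Lemma cmul0r x : x ** 0 = 0.
Proof. by rewrite -(scale0r (0 : A)) cmulZr !scale0r. Qed.

Lemma cmulNl x y : (- x) ** y = - (x ** y).
Proof. by rewrite -scaleN1r cmulZl scaleN1r. Qed.

Lemma cmulNr x y : x ** (- y) = - (x ** y).
Proof. by rewrite -scaleN1r cmulZr scaleN1r. Qed.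

Lemma cstar0 : (0 : A)^** = 0.
Proof. by rewrite -(scale0r (0 : A)) cstarZ conjc0 !scale0r. Qed.

Lemma cstarN x : (- x)^** = - x^**.
Proof. by rewrite -scaleN1r cstarZ rmorphN rmorph1 scaleN1r. Qed.

Definition cmulE :=
  (@cmulDl, @cmulDr, @cmulZl, @cmulZr, cmulNl, cmulNr, cmul0l, cmul0r).
Definition cstarE := (@cstarD, @cstarZ, @cstarM, @cstarK, cstarN, cstar0).

End StarAlgebra.

(** * C*-norms with real values *)

(** The modulus as an element of R rather than R[i], so that real inequalities
    between norms can be manipulated in R. *)
Definition cabs (R : realType) (k : R[i]) : R := complex.Re `|k|.

Lemma ReK (R : realType) (x : R[i]) : 0 <= x -> (complex.Re x)%:C = x.
Proof. by move=> x_ge0; rewrite RRe_real // ger0_real. Qed.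

Lemma cabsE (R : realType) (k : R[i]) : (cabs k)%:C = `|k|.
Proof. exact: ReK (normr_ge0 k). Qed.

Lemma cabs_real (R : realType) (r : R) : cabs r%:C = `|r|.
Proof. by rewrite /cabs normc_def /= expr0n addr0 sqrtr_sqr. Qed.

Lemma cabsM (R : realType) (a b : R[i]) : cabs (a * b) = cabs a * cabs b.
Proof. by apply: complexI; rewrite rmorphM /= !cabsE normrM. Qed.

Lemma cabs_ge0 (R : realType) (a : R[i]) : 0 <= cabs a.
Proof. by rewrite -lecR cabsE normr_ge0. Qed.

(** Norms on the underlying *-algebra, among them that of a corner of M_2(A). *)
Record cnorm (R : realType) (A : cstarAlgType R) := CNorm {
  nm :> A -> R;
  nmD : forall x y, nm (x + y) <= nm x + nm y;
  nmZ : forall k x, nm (k *: x) = cabs k * nm x;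
  nmM : forall x y, nm (x ** y) <= nm x * nm y;
  nm_star : forall x, nm (x^**) = nm x;
  nmC : forall x, nm (x^** ** x) = nm x ^+ 2;
  nm_eq0 : forall x, nm x = 0 -> x = 0 }.

Section CNormTheory.
Context {R : realType} {A : cstarAlgType R} (n : cnorm A).
Implicit Types x y z : A.

Lemma nm0 : n 0 = 0.
Proof. by rewrite -(scale0r (0 : A)) nmZ (cabs_real 0) normr0 mul0r. Qed.

Lemma nmN x : n (- x) = n x.
Proof.
by rewrite -scaleN1r nmZ -[-1]/(- (1%:C)) -rmorphN cabs_real normrN1 mul1r.
Qed.

Lemma nmB x y : n (x - y) <= n x + n y.
Proof. by rewrite -(nmN y) nmD. Qed.

Lemma nmBC x y : n (x - y) = n (y - x).
Proof. by rewrite -nmN opprB. Qed.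

Lemma nm_ge0 x : 0 <= n x.
Proof. by have := nmB x x; rewrite subrr nm0 -mulr2n pmulrn_lge0. Qed.

Lemma nmZr (r : R) x : 0 <= r -> n (r%:C *: x) = r * n x.
Proof. by move=> r_ge0; rewrite nmZ cabs_real ger0_norm. Qed.

Lemma nmCr x : n (x ** x^**) = n x ^+ 2.
Proof. by rewrite -{1}(cstarK x) nmC nm_star. Qed.

Lemma nm_sa_sqr x : x^** = x -> n (x ** x) = n x ^+ 2.
Proof. by move=> xsa; rewrite -{1}xsa nmC. Qed.

Lemma nmM_le x y a b : n x <= a -> n y <= b -> n (x ** y) <= a * b.
Proof.
by move=> xa yb; apply: le_trans (nmM n x y) _; rewrite ler_pM ?nm_ge0.
Qed.

Lemma nmD_le x y a b : n x <= a -> n y <= b -> n (x + y) <= a + b.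
Proof. by move=> xa yb; apply: le_trans (nmD n x y) _; rewrite lerD. Qed.

Lemma nm_le_sqr x c : 0 <= c -> n (x^** ** x) <= c ^+ 2 -> n x <= c.
Proof. by move=> c0; rewrite nmC ler_sqr ?nnegrE ?nm_ge0. Qed.

End CNormTheory.

(** * Approximate units *)

Section ApproximateUnit.
Context {R : realType} {A : cstarAlgType R} (n : cnorm A).
Context (h : A) (h_sa : h^** = h) (th : R[i]) (th_im : conjc th = - th).
Implicit Types w z : A.

Let rho : R := cabs th ^+ 2 * n h ^+ 2.

Let rho_ge0 : 0 <= rho.
Proof. by rewrite mulr_ge0 ?sqr_ge0. Qed.

(** As th is imaginary, |rho - th h|^2 = |rho^2 + |th|^2 h^2| is at most
    rho^2 + rho <= (rho + 1/2)^2: this is what the choice of rho is for. *)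
Lemma nm_shift_le z :
  n (rho%:C *: z - th *: (h ** z)) <= (rho + 2^-1) * n z.
Proof.
have rhoh_ge0 : 0 <= rho + 2^-1 by rewrite addr_ge0 ?invr_ge0.
apply: nm_le_sqr; first by rewrite mulr_ge0 ?nm_ge0.
have -> : (rho%:C *: z - th *: (h ** z))^** ** (rho%:C *: z - th *: (h ** z))
    = (rho ^+ 2)%:C *: (z^** ** z) - (th * th) *: ((h ** z)^** ** (h ** z)).
  rewrite !(cstarE, cmulE, cmulA) th_im h_sa conjc_real rmorphXn /=.
  lin R[i].
apply: le_trans (nmB _ _ _) _.
rewrite nmZr ?sqr_ge0 // nmZ !nmC cabsM.
have : n (h ** z) ^+ 2 <= (n h * n z) ^+ 2.
  by rewrite ler_sqr ?nnegrE ?mulr_ge0 ?nm_ge0 // nmM.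
move/(ler_wpM2l (mulr_ge0 (cabs_ge0 th) (cabs_ge0 th))) => hz.
have : 0 <= n z ^+ 2 by exact: sqr_ge0.
move: hz; rewrite /rho; set u := cabs th; set v := n h; set m := n z.
nra.
Qed.

Let F w : A :=
  ((1 + rho)^-1)%:C *: (rho%:C *: w - th *: (h ** w) + th *: h).
Let c : R := (rho + 2^-1) / (1 + rho).
Let ws j : A := iter j F 0.

Let rho1_gt0 : 0 < 1 + rho.
Proof. by rewrite ltr_wpDr. Qed.

Let c_ge0 : 0 <= c.
Proof. by rewrite divr_ge0 ?ltW // ltr_wpDl. Qed.

Let c_lt1 : c < 1.
Proof. by rewrite ltr_pdivrMr // mul1r; lra. Qed.

Let nm_step w w' : n (F w - F w') <= c * n (w - w').
Proof.
have -> : F w - F w' = ((1 + rho)^-1)%:C *: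
    (rho%:C *: (w - w') - th *: (h ** (w - w'))).
  by rewrite /F !cmulE; lin R[i].
rewrite nmZr ?invr_ge0 ?(ltW rho1_gt0) // [leLHS]mulrC /c [leRHS]mulrAC.
rewrite ler_pM2r ?invr_gt0 //.
exact: nm_shift_le.
Qed.

Let ws_diff j : n (ws j.+1 - ws j) <= c ^+ j * n (ws 1).
Proof.
elim: j => [|j IH]; first by rewrite expr0 mul1r subr0.
rewrite exprS -mulrA; apply: le_trans (nm_step _ _) _.
by rewrite ler_wpM2l.
Qed.

Let ws_bound j : n (ws j) <= n (ws 1) / (1 - c).
Proof.
have c1 : 0 < 1 - c by rewrite subr_gt0.
elim: j => [|j IH]; first by rewrite nm0 divr_ge0 ?nm_ge0 ?ltW.
rewrite ler_pdivlMr // in IH *.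
have : n (ws j.+1) <= c * n (ws j) + n (ws 1).
  rewrite -{1}[ws j.+1](subrK (ws 1)); apply: nmD_le => //.
  by apply: le_trans (nm_step _ _) _; rewrite subr0.
rewrite -(ler_pM2r c1) => le1.
have le2 := ler_wpM2l c_ge0 IH.
move: le1 le2; set x := n (ws j); set y := n (ws j.+1); set d := n (ws 1).
by rewrite ler_pdivlMr //; lra.
Qed.

Let ws_comm j : ws j ** h = h ** ws j.
Proof.
elim: j => [|j IH]; first by rewrite cmul0l cmul0r.
by rewrite /= -/(ws j) /F !cmulE -(cmulA h) IH.
Qed.

(** The equation w = th h (1 - w) says that 1 - w inverts 1 + th h.  It is
    equivalent to (1 + rho) w = (rho - th h) w + th h, a fixed point equation
    for a contraction by [nm_shift_le]; the iterates are approximate solutions,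
    and they commute with h because they are polynomials in h. *)
Lemma approx_resolvent : exists W : R, 0 <= W /\ forall eta : R, 0 < eta ->
  exists w, [/\ w ** h = h ** w, n w <= W & n (th *: (h - h ** w) - w) <= eta].
Proof.
exists (n (ws 1) / (1 - c)); split.
  by rewrite divr_ge0 ?nm_ge0 // subr_ge0 ltW.
move=> eta eta_gt0.
have c0 : `|c| < 1 by rewrite ger0_norm.
pose e := eta / ((1 + rho) * (1 + n (ws 1))).
have d_gt0 : 0 < 1 + n (ws 1) by rewrite ltr_wpDr ?nm_ge0.
have e_gt0 : 0 < e by rewrite divr_gt0 // mulr_gt0.
have [j cj] : exists j, c ^+ j <= e.
  have /cvgrPdist_le /(_ _ e_gt0) [j _ /(_ j (leqnn j))] := cvg_expr c0.
  by rewrite sub0r normrN ger0_norm ?exprn_ge0 //; exists j.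
exists (ws j); split=> //.
have -> : th *: (h - h ** ws j) - ws j = (1 + rho)%:C *: (ws j.+1 - ws j).
  have l0 : 1 + rho%:C != 0 :> R[i].
    have := lt0r_neq0 rho1_gt0.
    by rewrite -(fmorph_eq0 (real_complex R)) rmorphD rmorph1.
  rewrite /= -/(ws j) /F fmorphV rmorphD rmorph1.
  by lin R[i].
rewrite nmZr ?(ltW rho1_gt0) //.
move: (ws_diff j) cj; rewrite /e ler_pdivlMr ?mulr_gt0 //.
have := nm_ge0 n (ws 1); have := exprn_ge0 j c_ge0.
set x := c ^+ j; set d := n (ws 1); set y := n (_ - _) => x0 dge0 yxd xe.
have : (1 + rho) * y <= (1 + rho) * (x * d) by rewrite ler_pM2l.
have : 0 <= x * (1 + rho) by rewrite mulr_ge0 // ltW.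
nra.
Qed.

End ApproximateUnit.

Section ApproximateUnits.
Context {R : realType} {A : cstarAlgType R} (n : cnorm A).
Implicit Types h w z f : A.

(** This computes (1 - w^** ) th h (1 - w) in two ways: from th h (1 - w) =
    w + r, and from its adjoint. *)
Lemma resolvent_defect h w (th : R[i]) : h^** = h -> conjc th = - th ->
  let r := th *: (h - h ** w) - w in
  w + w^** - 2%:R *: (w^** ** w) = - r - r^** + w^** ** r + r^** ** w.
Proof.
move=> h_sa th_im r; rewrite /r !(cstarE, cmulE, cmulA) th_im h_sa.
by lin R[i].
Qed.

(** If w + w^** = 2 w^** w then 1 - 2w is an isometry, so w = (1 - (1 - 2w))/2
    has norm at most 1. *)
Lemma nm_le1_defect w :
  n w <= 1 + n (w + w^** - 2%:R *: (w^** ** w)).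
Proof.
set f := w + _ - _.
have f_ge0 := nm_ge0 n f.
have isom z : n (z - 2%:R *: (w ** z)) <= (1 + n f) * n z.
  apply: nm_le_sqr; first by rewrite mulr_ge0 ?nm_ge0 // addr_ge0.
  have -> : (z - 2%:R *: (w ** z))^** ** (z - 2%:R *: (w ** z)) =
      z^** ** z - 2%:R *: (z^** ** f ** z).
    rewrite /f !(cstarE, cmulE, cmulA) rmorph_nat; lin R[i].
  apply: le_trans (nmB _ _ _) _.
  have -> : 2%:R = (2%:R)%:C :> R[i] by rewrite rmorph_nat.
  rewrite nmZr // nmC.
  have := nmM_le (nmM_le (lexx (n z^**)) (lexx (n f))) (lexx (n z)).
  rewrite nm_star; have := sqr_ge0 (n z); have := sqr_ge0 (n f * n z).
  set u := n (_ ** _ ** _); set m := n z; set v := n f => *.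
  nra.
have half z : n (w ** z) <= (1 + n f) * n z.
  have : n (2%:R *: (w ** z)) <= n z + (1 + n f) * n z.
    have -> : 2%:R *: (w ** z) = z - (z - 2%:R *: (w ** z)) by lin R[i].
    by apply: le_trans (nmB _ _ _) _; rewrite lerD2l.
  have -> : 2%:R = (2%:R)%:C :> R[i] by rewrite rmorph_nat.
  rewrite nmZr //; have := mulr_ge0 f_ge0 (nm_ge0 n z); lra.
have := half w^**; rewrite nmCr nm_star expr2.
have [->|w_neq0] := eqVneq (n w) 0; first by rewrite addr_ge0.
by rewrite ler_pM2r // lt_def w_neq0 nm_ge0.
Qed.

(** If w = th h (1 - w) exactly, with th = i tau, then h (1 - w) = w / th has
    norm at most 1 / tau, and so has its adjoint h (1 - w^** ): (w + w^** )/2 is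
    self-adjoint and almost a unit for h.  The small excess of its norm over 1
    is removed by rescaling. *)
Lemma approx_unit h (d : R) : h^** = h -> 0 < d ->
  exists e, [/\ e^** = e, n e <= 1 & n (h - h ** e) <= d].
Proof.
move=> h_sa d_gt0.
pose tau := 4 / d; have tau_gt0 : 0 < tau by rewrite divr_gt0.
pose th : R[i] := tau%:C * 'i%C.
have th_im : conjc th = - th.
  by apply/eqP; rewrite eq_complex /=; apply/andP; split; apply/eqP; ring.
have th_abs : cabs th = tau.
  rewrite cabsM cabs_real ger0_norm ?ltW // /cabs normc_def /=.
  by rewrite expr0n expr1n add0r sqrtr1 mulr1.
have [W [W_ge0 Wres]] := approx_resolvent n h_sa th_im.
have nh := nm_ge0 n h.
(* G bounds the excess of the norm of w over 1; it is small enough for the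
   rescaling to move h by at most d / 2. *)
pose G := d / (2 * (1 + n h) * (1 + d)).
have G_gt0 : 0 < G by rewrite divr_gt0 // !mulr_gt0 //; lra.
have Gd : G * (2 * (1 + n h) * (1 + d)) = d.
  by rewrite divfK // lt0r_neq0 // !mulr_gt0 //; lra.
have G_half : G <= 2^-1.
  rewrite /G ler_pdivrMr ?mulr_gt0 //; [|lra|lra].
  have := mulr_ge0 nh (ltW d_gt0); lra.
clearbody G.
have eta_gt0 : 0 < G / (2 * (1 + W)) by rewrite divr_gt0 // mulr_gt0 //; lra.
have [w [wh wW r_le]] := Wres _ eta_gt0.
set r := th *: _ - _ in r_le.
have nr := nm_ge0 n r; have nw := nm_ge0 n w.
have rG : n r * (2 * (1 + W)) <= G by rewrite -ler_pdivlMr // mulr_gt0 //; lra.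
have r_half : n r <= 2^-1.
  have := mulr_ge0 nr W_ge0; lra.
have f_le : n (w + w^** - 2%:R *: (w^** ** w)) <= G.
  rewrite (resolvent_defect _ h_sa th_im) -/r.
  apply: (@le_trans _ _ (n r + n r + W * n r + n r * W)); last by nra.
  apply: nmD_le; first apply: nmD_le; first apply: nmD_le.
  - by rewrite nmN.
  - by rewrite nmN nm_star.
  - by apply: nmM_le; rewrite ?nm_star.
  - by apply: nmM_le; rewrite ?nm_star.
have w_le : n w <= 1 + G.
  by apply: le_trans (nm_le1_defect w) _; rewrite lerD2l.
have hw_le : n (h - h ** w) <= d / 2.
  have : n (th *: (h - h ** w)) <= (1 + G) + n r.
    by rewrite -{1}[_ *: _](subrK w) addrC; apply: nmD_le.
  rewrite nmZ th_abs /tau => le1.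
  have : 4 / d * n (h - h ** w) <= 2 by apply: le_trans le1 _; lra.
  by rewrite mulrAC ler_pdivrMr //; lra.
have e0_sa : (w + w^**)^** = w + w^** by rewrite !cstarE addrC.
have e0_le : n (w + w^**) <= 2 * (1 + G).
  have -> : 2 * (1 + G) = (1 + G) + (1 + G) by ring.
  by apply: nmD_le; rewrite ?nm_star.
have hwV_le : n (h - h ** w^**) <= d / 2.
  by rewrite -nm_star !cstarE h_sa wh.
pose s := (2 * (1 + G))^-1; have s_gt0 : 0 < s.
  by rewrite invr_gt0 mulr_gt0 //; lra.
have sG : s * (2 * (1 + G)) = 1 by rewrite mulVf // lt0r_neq0 // -invr_gt0.
exists (s%:C *: (w + w^**)); split.
- by rewrite cstarZ conjc_real e0_sa.
- rewrite nmZr ?(ltW s_gt0) //.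
  by apply: le_trans (ler_wpM2l (ltW s_gt0) e0_le) _; rewrite sG.
have -> : h - h ** (s%:C *: (w + w^**)) =
    s%:C *: ((h - h ** w) + (h - h ** w^**) + (2 * G)%:C *: h).
  have : (s * (2 * (1 + G)))%:C = 1 :> R[i] by rewrite sG.
  rewrite !(rmorphM, rmorphD, rmorph1) => sG'.
  rewrite !cmulE; lin R[i].
  by rewrite subr0 addr0 mulr0 subr0 -[1 in LHS]sG'; ring.
rewrite nmZr ?(ltW s_gt0) //.
rewrite -(ler_pM2l (_ : 0 < 2 * (1 + G))); last by rewrite -invr_gt0.
rewrite mulrA [_ * s]mulrC sG mul1r.
apply: (@le_trans _ _ (d / 2 + d / 2 + (2 * G) * n h)).
  apply: nmD_le; first exact: nmD_le.
  by rewrite nmZr // mulr_ge0 // ltW.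
nra.
Qed.

End ApproximateUnits.

(** * The norm of the corner of two by two matrices *)

Section OwnNorm.
Context {R : realType} {M : cstarAlgType R}.
Implicit Types x y : M.

Definition rnorm x : R := complex.Re `|x|.

Lemma rnormE x : (rnorm x)%:C = `|x|.
Proof. exact: ReK (normr_ge0 x). Qed.

Lemma rnormD x y : rnorm (x + y) <= rnorm x + rnorm y.
Proof. by rewrite -lecR rmorphD /= !rnormE ler_normD. Qed.

Lemma rnormZ k x : rnorm (k *: x) = cabs k * rnorm x.
Proof. by apply: complexI; rewrite rmorphM /= !rnormE cabsE normrZ. Qed.

Lemma rnormM x y : rnorm (x ** y) <= rnorm x * rnorm y.
Proof. by rewrite -lecR rmorphM /= !rnormE norm_cmul_le. Qed.

Lemma rnormC x : rnorm (x^** ** x) = rnorm x ^+ 2.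
Proof. by apply: complexI; rewrite rmorphXn /= !rnormE norm_cstar_mul. Qed.

Lemma rnorm_ge0 x : 0 <= rnorm x.
Proof. by rewrite -lecR rnormE normr_ge0. Qed.

Lemma rnorm_star x : rnorm x^** = rnorm x.
Proof.
have le y : rnorm y <= rnorm y^**.
  have := rnormM y^** y; rewrite rnormC expr2.
  have [->|y_neq0] := eqVneq (rnorm y) 0; first by rewrite rnorm_ge0.
  by rewrite ler_pM2r // lt_def y_neq0 rnorm_ge0.
by apply/le_anti; rewrite le /= -{2}(cstarK x) le.
Qed.

Lemma rnorm_eq0 x : rnorm x = 0 -> x = 0.
Proof. by move=> x0; apply/eqP; rewrite -normr_eq0 -rnormE x0. Qed.

End OwnNorm.

Section Corner.
Context {R : realType} {A M : cstarAlgType R} (phi : 'M[A]_2 -> M).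
Context (phi_M2 : is_M2 phi).

Definition mx4 (T : cstarAlgType R) (a b c d : T) : 'M[T]_2 :=
  \matrix_(i, j) if i == 0 then if j == 0 then a else b
                 else if j == 0 then c else d.

Lemma mx4_mul (T : cstarAlgType R) (a b c d a' b' c' d' : T) :
  mx2_mul (mx4 a b c d) (mx4 a' b' c' d') =
  mx4 (a ** a' + b ** c') (a ** b' + b ** d')
      (c ** a' + d ** c') (c ** b' + d ** d').
Proof.
apply/matrixP => i j; rewrite !mxE !big_ord_recl big_ord0 addr0 !mxE /=.
by case: (i == 0); case: (j == 0).
Qed.

Lemma mx4_star (T : cstarAlgType R) (a b c d : T) :
  mx2_star (mx4 a b c d) = mx4 a^** c^** b^** d^**.
Proof. by apply/matrixP => i j; rewrite !mxE; case: ifP; case: ifP. Qed.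

Lemma mx4_add (T : cstarAlgType R) (a b c d a' b' c' d' : T) :
  mx4 a b c d + mx4 a' b' c' d' = mx4 (a + a') (b + b') (c + c') (d + d').
Proof. by apply/matrixP => i j; rewrite !mxE; case: ifP; case: ifP. Qed.

Lemma mx4_map (T U : cstarAlgType R) (f : T -> U) (a b c d : T) :
  map_mx f (mx4 a b c d) = mx4 (f a) (f b) (f c) (f d).
Proof. by apply/matrixP => i j; rewrite !mxE; case: ifP; case: ifP. Qed.

Let phiD x y : phi (x + y) = phi x + phi y. Proof. by case: phi_M2. Qed.
Let phiZ k x : phi (map_mx ( *:%R k) x) = k *: phi x.
Proof. by case: phi_M2. Qed.
Let phiM x y : phi (mx2_mul x y) = phi x ** phi y. Proof. by case: phi_M2. Qed.
Let phi_star x : phi (mx2_star x) = (phi x)^**. Proof. by case: phi_M2. Qed.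
Let phi_inj : injective phi. Proof. by case: phi_M2 => /bij_inj. Qed.

Definition corner_norm (x : A) : R := rnorm (phi (mx4 x 0 0 0)).

Lemma corner_normD x y : corner_norm (x + y) <= corner_norm x + corner_norm y.
Proof.
have := rnormD (phi (mx4 x 0 0 0)) (phi (mx4 y 0 0 0)).
by rewrite -phiD mx4_add !addr0.
Qed.

Lemma corner_normZ k x : corner_norm (k *: x) = cabs k * corner_norm x.
Proof. by rewrite -rnormZ -phiZ mx4_map !scaler0. Qed.

Lemma corner_normM x y : corner_norm (x ** y) <= corner_norm x * corner_norm y.
Proof.
apply: le_trans (rnormM _ _).
by rewrite -phiM mx4_mul !(cmul0l, cmul0r) !addr0.
Qed.

Lemma corner_norm_star x : corner_norm x^** = corner_norm x.
Proof. by rewrite -[RHS]rnorm_star -phi_star mx4_star !cstar0. Qed.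

Lemma corner_normC x : corner_norm (x^** ** x) = corner_norm x ^+ 2.
Proof.
rewrite -rnormC -phi_star -phiM mx4_star mx4_mul.
by rewrite !(cstar0, cmul0l, cmul0r) !addr0.
Qed.

Lemma corner_norm_eq0 x : corner_norm x = 0 -> x = 0.
Proof.
have phi0 : phi 0 = 0 by apply: (addrI (phi 0)); rewrite -phiD !addr0.
move=> /rnorm_eq0; rewrite -phi0 => /phi_inj.
by move/matrixP/(_ 0 0); rewrite !mxE.
Qed.

Definition corner : cnorm A :=
  CNorm corner_normD corner_normZ corner_normM corner_norm_star
    corner_normC corner_norm_eq0.

(** The square of the norm of a row is the norm of the diagonal corner x x^** +
    y y^** of its product with its adjoint. *)
Lemma corner_row x y :
  rnorm (phi (mx4 x y 0 0)) ^+ 2 = corner (x ** x^** + y ** y^**).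
Proof.
rewrite -rnorm_star -rnormC cstarK -phi_star -phiM mx4_star mx4_mul.
by rewrite !(cstar0, cmul0l, cmul0r) !addr0.
Qed.

(** A column and its reflection (y, -x) have the same norm, and y E11 is their
    mean, so its norm is at most that of the column. *)
Lemma corner_col x y : corner y ^+ 2 <= corner (y^** ** y + x^** ** x).
Proof.
have col a b : rnorm (phi (mx4 a 0 b 0)) ^+ 2 = corner (a^** ** a + b^** ** b).
  rewrite -rnormC -phi_star -phiM mx4_star mx4_mul.
  by rewrite !(cstar0, cmul0l, cmul0r) !addr0.
rewrite -col ler_sqr ?nnegrE ?rnorm_ge0 ?nm_ge0 //.
have eqN : rnorm (phi (mx4 y 0 (- x) 0)) = rnorm (phi (mx4 y 0 x 0)).
  apply/eqP; rewrite -(@eqrXn2 _ 2) ?rnorm_ge0 // !col.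
  by rewrite !(cstarE, cmulE) opprK.
have := rnormD (phi (mx4 y 0 x 0)) (phi (mx4 y 0 (- x) 0)).
rewrite eqN -phiD mx4_add !addr0 subrr.
rewrite -[rnorm (phi (mx4 (y + y) 0 0 0))]/(corner (y + y)).
have -> : y + y = (2%:R)%:C *: y by rewrite rmorph_nat scaler_nat mulr2n.
rewrite nmZr // -/(rnorm _); lra.
Qed.

End Corner.

(** * Self-adjoint elements whose small multiples move a unit slowly *)

Lemma prim_root_exists (C : numClosedFieldType) (p : nat) :
  (0 < p)%N -> exists z : C, p.-primitive_root z.
Proof.
move=> p_gt0; have [r Dp] := closed_field_poly_normal ('X^p - 1 : {poly C}).
rewrite (monicP _) ?monicXnsubC // scale1r in Dp.
have rn1 : all p.-unity_root r.
  by apply/allP => z; rewrite -root_prod_XsubC -Dp.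
have sz_r : (p < (size r).+1)%N.
  by rewrite -(size_prod_XsubC r id) -Dp size_XnsubC.
have [|z] := hasP (has_prim_root p_gt0 rn1 _ sz_r); last by exists z.
by rewrite -separable_prod_XsubC -Dp separable_Xn_sub_1 // pnatr_eq0 -lt0n.
Qed.

Lemma sum_prim_root (C : numClosedFieldType) (p m : nat) (w : C) :
  p.-primitive_root w -> (0 < m < p)%N -> \sum_(j < p) w ^+ (j * m) = 0.
Proof.
move=> w_prim /andP[m_gt0 m_lt].
have wm : w ^+ m - 1 != 0.
  rewrite subr_eq0 -(prim_order_dvd w_prim); apply/negP => /dvdn_leq.
  by move/(_ m_gt0); rewrite leqNgt m_lt.
apply: (mulfI wm); rewrite mulr0.
under eq_bigr do rewrite mulnC exprM.
by rewrite -subrX1 exprAC (prim_expr_order w_prim) expr1n subrr.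
Qed.

Section Rigidity.
Context {R : realType} {B : cstarAlgType R} (n : cnorm B).
Context (g k : B) (g_sa : g^** = g) (k_sa : k^** = k) (t : R) (t_ge0 : 0 <= t).

Let d := n (g ** k - k).
Let q := 1 + t * n k.

Let q_ge1 : 1 <= q.
Proof. by rewrite lerDl mulr_ge0 ?nm_ge0. Qed.

Let d_ge0 : 0 <= d.
Proof. exact: nm_ge0. Qed.

(** Writing z = a + i b, the square of the modulus of g + z t k exceeds that of
    g + a t k by the commutator term t i b (g k - k g) and by t^2 b^2 k^2, and
    g + a t k is a convex combination of g + t k and g - t k. *)
Lemma nm_rotate (y : R) (z : R[i]) : cabs z = 1 ->
  n (g + t%:C *: k) <= 1 + y -> n (g - t%:C *: k) <= 1 + y ->
  n (g + (z * t%:C) *: k) ^+ 2 <= (1 + y) ^+ 2 + 2 * t * d + t ^+ 2 * n k ^+ 2.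
Proof.
move=> z1 le_p le_m.
have y_ge0 : 0 <= 1 + y by apply: le_trans (nm_ge0 _ _) le_p.
pose a : R := complex.Re z; pose b : R := complex.Im z.
pose ib : R[i] := 'i%C * b%:C.
have zE : z = a%:C + ib by rewrite [LHS]complexE.
have zcE : conjc z = a%:C - ib.
  rewrite zE; apply/eqP; rewrite eq_complex /=.
  by apply/andP; split; apply/eqP; ring.
have ab1 : a ^+ 2 + b ^+ 2 = 1.
  by apply: complexI; rewrite add_Re2_Im2 -cabsE z1 rmorph1 expr1n.
have ib2 : ib * ib = - (b ^+ 2)%:C.
  by apply/eqP; rewrite eq_complex /=; apply/andP; split; apply/eqP; ring.
have ibabs : cabs ib = `|b|.
  rewrite cabsM cabs_real {1}/cabs normc_def /=.
  by rewrite expr0n expr1n add0r sqrtr1 mul1r.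
have b1 : `|b| <= 1.
  rewrite -(@expr_le1 _ 2) // real_normK ?num_real //.
  by have := sqr_ge0 a; lra.
have a1 : `|a| <= 1.
  rewrite -(@expr_le1 _ 2) // real_normK ?num_real //.
  by have := sqr_ge0 b; lra.
have comm_le : n (g ** k - k ** g) <= 2 * d.
  have -> : g ** k - k ** g = (g ** k - k) - (g ** k - k)^**.
    by rewrite !cstarE g_sa k_sa; lin R[i].
  by apply: le_trans (nmB _ _ _) _; rewrite nm_star -/d; lra.
have at_le : n (g + (a * t)%:C *: k) <= 1 + y.
  have -> : g + (a * t)%:C *: k =
      ((1 + a) / 2)%:C *: (g + t%:C *: k) + ((1 - a) / 2)%:C *: (g - t%:C *: k).
    rewrite !(rmorphM, rmorphB, rmorphD, rmorph1) fmorphV rmorphD rmorph1.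
    by lin R[i].
  move: a1; rewrite ler_norml => /andP[am ap].
  apply: (@le_trans _ _ ((1 + a) / 2 * (1 + y) + (1 - a) / 2 * (1 + y))).
    by apply: nmD_le; rewrite nmZr ?ler_wpM2l // divr_ge0 //; lra.
  by lra.
rewrite -nmC.
have -> : (g + (z * t%:C) *: k)^** ** (g + (z * t%:C) *: k) =
    (g + (a * t)%:C *: k)^** ** (g + (a * t)%:C *: k)
    + (t%:C * ib) *: (g ** k - k ** g) + (t ^+ 2 * b ^+ 2)%:C *: (k ** k).
  rewrite !(cstarE, cmulE) !conjcM !conjc_real zcE zE g_sa k_sa !rmorphM.
  have -> : (b%:C * b%:C) = - (ib * ib) by rewrite ib2 opprK rmorphXn expr2.
  by lin R[i].
have -> : (1 + y) ^+ 2 + 2 * t * d + t ^+ 2 * n k ^+ 2 =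
  (1 + y) ^+ 2 + t * (2 * d) + t ^+ 2 * n k ^+ 2 by ring.
apply: nmD_le; first apply: nmD_le.
- by rewrite nmC ler_sqr ?nnegrE ?nm_ge0.
- rewrite nmZ cabsM cabs_real ibabs (ger0_norm t_ge0) -mulrA ler_wpM2l //.
  by have := ler_pM (normr_ge0 b) (nm_ge0 n _) b1 comm_le; rewrite mul1r.
- rewrite (nmZr _ _ (mulr_ge0 (sqr_ge0 t) (sqr_ge0 b))) nm_sa_sqr //.
  rewrite ler_wpM2r ?sqr_ge0 //.
  by rewrite ler_piMr ?sqr_ge0 //; have := sqr_ge0 a; lra.
Qed.

(** (1 + z t k)^N k, on which g acts almost as a unit. *)
Let E (z : R[i]) N : B := iter N (fun u => u + (z * t%:C) *: (k ** u)) k.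

Let nm_tk z u : cabs z = 1 -> n ((z * t%:C) *: (k ** u)) <= t * n k * n u.
Proof.
move=> z1; rewrite nmZ cabsM z1 mul1r cabs_real ger0_norm // -mulrA.
by rewrite ler_wpM2l // nmM.
Qed.

Let E_le z N : cabs z = 1 -> n (E z N) <= n k * q ^+ N.
Proof.
move=> z1; elim: N => [|N IH]; first by rewrite expr0 mulr1.
rewrite /= -/(E z N); apply: le_trans (nmD_le (lexx _) (nm_tk _ z1)) _.
rewrite exprSr mulrA; apply: le_trans (ler_wpM2r (le_trans ler01 q_ge1) IH).
by rewrite /q; lra.
Qed.

Let E_unit z N : cabs z = 1 -> n (g ** E z N - E z N) <= d * q ^+ N.
Proof.
move=> z1; elim: N => [|N IH]; first by rewrite expr0 mulr1.
rewrite /= -/(E z N).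
have -> : g ** (E z N + (z * t%:C) *: (k ** E z N)) -
    (E z N + (z * t%:C) *: (k ** E z N)) =
    (g ** E z N - E z N) + (z * t%:C) *: ((g ** k - k) ** E z N).
  by rewrite !cmulE cmulA; lin R[i].
apply: le_trans (nmD_le IH (lexx _)) _.
rewrite nmZ cabsM z1 mul1r cabs_real ger0_norm //.
have := nmM_le (lexx d) (E_le N z1) => /(ler_wpM2l t_ge0) le1.
apply: le_trans (lerD (lexx _) le1) _.
by rewrite exprSr {4}/q; lra.
Qed.

Let E_growth (y : R) z N : cabs z = 1 -> 0 <= y ->
  n (g + (z * t%:C) *: k) <= 1 + y ->
  n (E z N) <= (1 + y) ^+ N * (n k + N%:R * d * q ^+ N).
Proof.
move=> z1 y_ge0 le_y; elim: N => [|N IH].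
  by rewrite expr0 mul1r mul0r mul0r addr0.
have -> : E z N.+1 = (g + (z * t%:C) *: k) ** E z N - (g ** E z N - E z N).
  by rewrite /= -/(E z N) !cmulE; lin R[i].
apply: le_trans (nmB _ _ _) _.
apply: le_trans (lerD (nmM_le le_y IH) (E_unit N z1)) _.
have Y_ge1 : 1 <= (1 + y) ^+ N.+1 by rewrite exprn_ege1 // lerDl.
have qN : q ^+ N <= q ^+ N.+1.
  by rewrite exprS ler_peMl // exprn_ge0 // (le_trans _ q_ge1).
have q0 : 0 <= q ^+ N by rewrite exprn_ge0 // (le_trans _ q_ge1).
rewrite mulrA -exprS.
set Y := (1 + y) ^+ N.+1 in Y_ge1 *.
apply: (@le_trans _ _ (Y * (n k + N%:R * d * q ^+ N.+1) + Y * (d * q ^+ N.+1))).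
  apply: lerD.
    rewrite ler_wpM2l ?(le_trans _ Y_ge1) // lerD2l ler_wpM2l //.
    by rewrite mulr_ge0.
  apply: (@le_trans _ _ (d * q ^+ N.+1)); first by rewrite ler_wpM2l.
  by rewrite ler_peMl // mulr_ge0 // (le_trans q0).
by rewrite -mulrDr -addrA -[in leRHS]natr1 !mulrDl mul1r.
Qed.

Let average (w : R[i]) p m N : B := \sum_(j < p) w ^+ (j * m) *: E (w ^+ j) N.

Let averageS w p m N :
  average w p m N.+1 = average w p m N + t%:C *: (k ** average w p m.+1 N).
Proof.
rewrite /average (big_morph (cmul k) (@cmulDr _ _ k) (cmul0r k)) scaler_sumr.
rewrite -big_split; apply: eq_bigr => j _ /=.
rewrite scalerDr cmulZr !scalerA; congr (_ + _ *: _).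
by rewrite mulnS exprD; ring.
Qed.

(** The average over p-th roots of unity w of w^-1 (1 + w t k)^N k, with p > N,
    retains only the term N t k^2 of the binomial expansion.  With p = N + 1 the
    weight w^-1 is w^N. *)
Let average_linear w N : N.+1.-primitive_root w -> (0 < N)%N ->
  average w N.+1 N N = ((N.+1 * N)%:R * t%:C) *: (k ** k).
Proof.
move=> w_prim N_gt0.
have zero M m : (0 < m)%N -> (m + M < N.+1)%N -> average w N.+1 m M = 0.
  elim: M m => [|M IH] m m_gt0.
    rewrite addn0 => m_lt; rewrite /average /= -scaler_suml.
    by rewrite sum_prim_root ?scale0r // m_gt0.
  rewrite addnS => mM; rewrite averageS !IH ?cmul0r ?scaler0 ?addr0 //.
  by rewrite ltnW.
have shift M : average w N.+1 N.+2 M = average w N.+1 1 M.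
  apply: eq_bigr => j _; congr (_ *: _).
  rewrite -(addn1 N.+1) mulnDr exprD mulnC exprM.
  by rewrite (prim_expr_order w_prim) expr1n mul1r.
have const M : (M <= N)%N -> average w N.+1 N.+1 M = (N.+1)%:R *: k.
  elim: M => [|M IH] MN.
    rewrite /average /= -scaler_suml; congr (_ *: _).
    under eq_bigr do rewrite mulnC exprM (prim_expr_order w_prim) expr1n.
    by rewrite sumr_const card_ord.
  by rewrite averageS shift (zero M 1%N) // cmul0r scaler0 addr0 IH // ltnW.
suff lin_term M : (M <= N)%N ->
  average w N.+1 N M = ((N.+1 * M)%:R * t%:C) *: (k ** k) by exact: lin_term.
elim: M => [|M IH] MN.
  by rewrite zero ?addn0 // muln0 mul0r scale0r.
rewrite averageS IH ?const 1?ltnW // cmulZr scalerA -scalerDl.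
by rewrite mulnS natrD; congr (_ *: _); ring.
Qed.

(** Fed with N t = T and t small, so that the right side tends to the norm of k
    when g k = k, this forces T |k| <= 1 for every T. *)
Lemma rigidity_bound (y y' : R) (N : nat) : (0 < N)%N -> 0 <= y' ->
  n (g + t%:C *: k) <= 1 + y -> n (g - t%:C *: k) <= 1 + y ->
  (1 + y) ^+ 2 + 2 * t * d + t ^+ 2 * n k ^+ 2 <= (1 + y') ^+ 2 ->
  N%:R * t * n k ^+ 2 <= (1 + y') ^+ N * (n k + N%:R * d * q ^+ N).
Proof.
move=> N_gt0 y'_ge0 le_p le_m yy'.
have [w w_prim] := prim_root_exists R[i] (ltn0Sn N).
have w1 : cabs w = 1.
  have : cabs w ^+ N.+1 = 1.
    apply: complexI; rewrite rmorphXn /= cabsE -normrX.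
    by rewrite (prim_expr_order w_prim) normr1.
  by move/eqP; rewrite pexprn_eq1 ?cabs_ge0 //= => /eqP.
have wj1 j : cabs (w ^+ j) = 1.
  by apply: complexI; rewrite cabsE normrX -cabsE w1 expr1n.
have : n (average w N.+1 N N) <=
    (N.+1)%:R * ((1 + y') ^+ N * (n k + N%:R * d * q ^+ N)).
  rewrite mulr_natl -[N.+1 in leRHS]card_ord -sumr_const.
  apply: (@le_trans _ _ (\sum_(j < N.+1) n (w ^+ (j * N) *: E (w ^+ j) N))).
    rewrite /average; elim/big_ind2: _ => [|? ? ? ? ? ?|//].
      by rewrite nm0.
    exact: nmD_le.
  apply: ler_sum => j _; rewrite nmZ wj1 mul1r; apply: E_growth => //.
  rewrite -ler_sqr ?nnegrE ?nm_ge0 ?addr_ge0 //.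
  exact: le_trans (nm_rotate (wj1 j) le_p le_m) yy'.
rewrite average_linear // -[(_ * _)%:R](rmorph_nat (real_complex R)) -rmorphM.
rewrite nmZr ?mulr_ge0 // nm_sa_sqr // natrM -!mulrA ler_pM2l ?ltr0n //.
Qed.

End Rigidity.

(** * Sequences modulo null sequences *)

Definition smul (R : realType) (A : cstarAlgType R) (x y : nat -> A) :
    nat -> A :=
  fun m => x m ** y m.
Definition sstar (R : realType) (A : cstarAlgType R) (x : nat -> A) :
    nat -> A :=
  fun m => (x m)^**.
Local Notation "x <*> y" := (smul x y) (at level 40, left associativity).

Section SeqAlgebra.
Context {R : realType} {A : cstarAlgType R}.
Implicit Types x y z : nat -> A.

Lemma smulA x y z : x <*> (y <*> z) = x <*> y <*> z.
Proof. by apply/funext => m; rewrite /smul cmulA. Qed.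
Lemma smulDl x y z : (x + y) <*> z = x <*> z + y <*> z.
Proof. by apply/funext => m; apply: cmulDl. Qed.
Lemma smulDr x y z : x <*> (y + z) = x <*> y + x <*> z.
Proof. by apply/funext => m; apply: cmulDr. Qed.
Lemma smulZl (k : R[i]) x y : (k *: x) <*> y = k *: (x <*> y).
Proof. by apply/funext => m; apply: cmulZl. Qed.
Lemma smulZr (k : R[i]) x y : x <*> (k *: y) = k *: (x <*> y).
Proof. by apply/funext => m; apply: cmulZr. Qed.
Lemma smulNl x y : (- x) <*> y = - (x <*> y).
Proof. by apply/funext => m; apply: cmulNl. Qed.
Lemma smulNr x y : x <*> (- y) = - (x <*> y).
Proof. by apply/funext => m; apply: cmulNr. Qed.
Lemma sstarD x y : sstar (x + y) = sstar x + sstar y.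
Proof. by apply/funext => m; apply: cstarD. Qed.
Lemma sstarN x : sstar (- x) = - sstar x.
Proof. by apply/funext => m; apply: cstarN. Qed.
Lemma sstarZ (k : R[i]) x : sstar (k *: x) = conjc k *: sstar x.
Proof. by apply/funext => m; apply: cstarZ. Qed.
Lemma sstarM x y : sstar (x <*> y) = sstar y <*> sstar x.
Proof. by apply/funext => m; apply: cstarM. Qed.
Lemma sstarK x : sstar (sstar x) = x.
Proof. by apply/funext => m; apply: cstarK. Qed.

Definition smulE := (smulDl, smulDr, smulZl, smulZr, smulNl, smulNr).
Definition sstarE := (sstarD, sstarN, sstarZ, sstarM, sstarK).
End SeqAlgebra.

Section SeqEquiv.
Context {R : realType} {A : cstarAlgType R} (n : cnorm A).
Implicit Types x y z : nat -> A.

Definition bounded_seq x := exists C : R, forall m, n (x m) <= C.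
Definition null_seq x :=
  forall eps : R, 0 < eps -> \forall m \near \oo%classic, n (x m) <= eps.

(** A partial equivalence: it is reflexive exactly on bounded sequences, which
    makes it compatible with products without side conditions. *)
Definition seqv x y := [/\ bounded_seq x, bounded_seq y & null_seq (x - y)].

Lemma bounded_seqD x y : bounded_seq x -> bounded_seq y -> bounded_seq (x + y).
Proof. by move=> [a xa] [b yb]; exists (a + b) => m; apply: nmD_le. Qed.

Lemma bounded_seqM x y :
  bounded_seq x -> bounded_seq y -> bounded_seq (x <*> y).
Proof. by move=> [a xa] [b yb]; exists (a * b) => m; apply: nmM_le. Qed.

Lemma bounded_seqZ (k : R[i]) x : bounded_seq x -> bounded_seq (k *: x).
Proof.
by move=> [a xa]; exists (cabs k * a) => m; rewrite nmZ ler_wpM2l ?cabs_ge0.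
Qed.

Lemma bounded_seq_star x : bounded_seq x -> bounded_seq (sstar x).
Proof. by move=> [a xa]; exists a => m; rewrite nm_star. Qed.

Lemma bounded_seq_pos x : bounded_seq x ->
  exists2 C : R, 0 < C & forall m, n (x m) <= C.
Proof.
move=> [a xa]; exists (1 + `|a|); first by rewrite ltr_wpDr.
by move=> m; rewrite (le_trans (xa m)) // (le_trans (ler_norm _)) // lerDr.
Qed.

Lemma null_seqD x y : null_seq x -> null_seq y -> null_seq (x + y).
Proof.
move=> x0 y0 eps eps0; have e2 : 0 < eps / 2 by rewrite divr_gt0.
apply: filterS2 (x0 _ e2) (y0 _ e2) => m xm ym.
by rewrite [eps]splitr; apply: nmD_le.
Qed.

Lemma null_seqMl x y : bounded_seq x -> null_seq y -> null_seq (x <*> y).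
Proof.
move=> /bounded_seq_pos[C C0 xC] y0 eps eps0.
have e2 : 0 < eps / C by rewrite divr_gt0.
apply: filterS (y0 _ e2) => m ym.
by apply: le_trans (nmM_le (xC m) ym) _; rewrite mulrCA divff ?mulr1 ?gt_eqF.
Qed.

Lemma null_seq_star x : null_seq x -> null_seq (sstar x).
Proof. by move=> x0 eps /x0; apply: filterS => m; rewrite nm_star. Qed.

Lemma null_seqMr x y : null_seq x -> bounded_seq y -> null_seq (x <*> y).
Proof.
move=> x0 yb; rewrite -[_ <*> _]sstarK; apply: null_seq_star; rewrite sstarM.
by apply: null_seqMl; [apply: bounded_seq_star|apply: null_seq_star].
Qed.

Lemma null_seqZ (k : R[i]) x : null_seq x -> null_seq (k *: x).
Proof.
move=> x0 eps eps0; have k0 : 0 < 1 + cabs k by rewrite ltr_wpDr ?cabs_ge0.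
have e2 : 0 < eps / (1 + cabs k) by rewrite divr_gt0.
apply: filterS (x0 _ e2) => m; rewrite ler_pdivlMr // nmZ => xm.
by have := nm_ge0 n (x m); move: xm; lra.
Qed.

Lemma seqv_refl x : bounded_seq x -> seqv x x.
Proof.
move=> xb; split=> // eps eps0; apply: nearW => m.
by rewrite subrr nm0 ltW.
Qed.

Lemma seqv_bounded x y : seqv x y -> bounded_seq x. Proof. by case. Qed.

Lemma seqv_sym x y : seqv x y -> seqv y x.
Proof.
move=> [xb yb xy]; split=> // eps /xy; apply: filterS => m.
by rewrite -nmN opprB.
Qed.

Lemma seqv_trans y x z : seqv x y -> seqv y z -> seqv x z.
Proof.
move=> [xb _ xy] [_ zb yz]; split=> //.
by rewrite -(subrK y x) -addrA; apply: null_seqD.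
Qed.

Lemma seqvZ (k : R[i]) x y : seqv x y -> seqv (k *: x) (k *: y).
Proof.
move=> [xb yb xy]; split; try exact: bounded_seqZ.
by rewrite -scalerBr; apply: null_seqZ.
Qed.

Lemma seqvN x y : seqv x y -> seqv (- x) (- y).
Proof. by move=> /(seqvZ (-1)); rewrite !scaleN1r. Qed.

Lemma seqvD x y x' y' : seqv x x' -> seqv y y' -> seqv (x + y) (x' + y').
Proof.
move=> [xb xb' xx] [yb yb' yy]; split; try exact: bounded_seqD.
by rewrite opprD addrACA; apply: null_seqD.
Qed.

Lemma seqvB x y x' y' : seqv x x' -> seqv y y' -> seqv (x - y) (x' - y').
Proof. by move=> xx yy; apply: seqvD => //; apply: seqvN. Qed.

Lemma seqvM x y x' y' : seqv x x' -> seqv y y' -> seqv (x <*> y) (x' <*> y').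
Proof.
move=> [xb xb' xx] [yb yb' yy]; split; try exact: bounded_seqM.
have -> : x <*> y - x' <*> y' = (x - x') <*> y + x' <*> (y - y').
  by rewrite !smulE; lin R[i].
by apply: null_seqD; [apply: null_seqMr|apply: null_seqMl].
Qed.

Lemma seqv_star x y : seqv x y -> seqv (sstar x) (sstar y).
Proof.
move=> [xb yb xy]; split; try exact: bounded_seq_star.
by rewrite -sstarN -sstarD; apply: null_seq_star.
Qed.

Lemma seqv_subr0 x y :
  bounded_seq x -> bounded_seq y -> seqv (x - y) 0 -> seqv x y.
Proof. by move=> xb yb [_ _]; rewrite subr0. Qed.

Lemma seqv_sub0 x y : seqv x y -> seqv (x - y) 0.
Proof.
move=> xy; rewrite -(subrr y); apply: seqvB => //; apply: seqv_refl.
by case: xy.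
Qed.

Lemma bounded_seq_cst (a : A) : bounded_seq (fun=> a).
Proof. by exists (n a). Qed.

Lemma seqv_cst_eq (a b : A) : seqv (fun=> a) (fun=> b) -> a = b.
Proof.
move=> [_ _ ab]; apply/eqP; rewrite -subr_eq0; apply/eqP/(nm_eq0 (c:=n)).
apply/le_anti; rewrite nm_ge0 andbT; apply/ler_addgt0Pl => eps /ab [M _ /(_ M)].
by rewrite addr0; apply; rewrite /= leqnn.
Qed.

(** The form in which the C*-identity passes to limits. *)
Lemma seqv0_of_square x : bounded_seq x -> seqv (sstar x <*> x) 0 -> seqv x 0.
Proof.
move=> xb [_ _ xx]; split=> //; first by exists 0 => m; rewrite nm0.
move=> eps eps0; apply: filterS (xx _ (exprn_gt0 2 eps0)) => m.
by rewrite !subr0 nmC ler_sqr // nnegrE ?nm_ge0 // ltW.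
Qed.

End SeqEquiv.

(** * Row contractive triple homomorphisms *)

Section TripleHom.
Context {R : realType} {A B : cstarAlgType R} (nA : cnorm A) (nB : cnorm B).
Context (S : {linear A -> B}) (S_triple : triple_hom S).
Context (S_row : forall x y : A,
  nB (S x ** (S x)^** + S y ** (S y)^**) <= nA (x ** x^** + y ** y^**)).

Lemma triple_hom_sym (a b c : A) :
  S (a ** b^** ** c + c ** b^** ** a) =
  S a ** (S b)^** ** S c + S c ** (S b)^** ** S a.
Proof.
have := S_triple a b c; rewrite /triple linearZ /= => /(congr1 ( *:%R 2%:R)).
by rewrite !scalerA mulfV ?pnatr_eq0 // !scale1r.
Qed.

Lemma triple_hom_quad (a b : A) : S (a ** b^** ** a) = S a ** (S b)^** ** S a.
Proof.
have half (u : B) : 2^-1 *: (u + u) = u by lin R[i].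
by rewrite -[LHS]half -[RHS]half -linearD triple_hom_sym.
Qed.

Lemma row_contractive (x : A) : nB (S x) <= nA x.
Proof.
have := S_row x 0; rewrite linear0 !cstar0 !cmul0r !addr0 !nmCr.
by rewrite ler_sqr // nnegrE nm_ge0.
Qed.

Definition mapS (x : nat -> A) : nat -> B := fun m => S (x m).

Lemma mapS_seqv x y : seqv nA x y -> seqv nB (mapS x) (mapS y).
Proof.
have bd z : bounded_seq nA z -> bounded_seq nB (mapS z).
  by move=> [C zC]; exists C => m; apply: le_trans (row_contractive _) (zC m).
move=> [/bd xb /bd yb xy]; split=> // eps /xy; apply: filterS => m.
apply: le_trans; apply: le_trans (row_contractive _).
by rewrite linearB.
Qed.

Section LocalUnit.
Context (e : nat -> A) (e_sa : forall m, (e m)^** = e m)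
  (e_le1 : forall m, nA (e m) <= 1).

Let cA (x : A) : nat -> A := fun=> x.
Let sg (x : A) : nat -> B := fun=> S x.
Let s := mapS e.
Let g := s <*> sstar s.
Let g' := sstar s <*> s.

(** The elements for which e is an asymptotic unit form a *-algebra. *)
Definition unit_on (x : A) : Prop :=
  seqv nA (e <*> cA x) (cA x) /\ seqv nA (cA x <*> e) (cA x).

Let e_star : sstar e = e.
Proof. by apply/funext => m; apply: e_sa. Qed.

Let e_bdd : bounded_seq nA e. Proof. by exists 1. Qed.
Let e_refl := seqv_refl e_bdd.
Let cA_refl x : seqv nA (cA x) (cA x).
Proof. exact: (seqv_refl (bounded_seq_cst nA x)). Qed.
Let sg_refl x : seqv nB (sg x) (sg x).
Proof. exact: (seqv_refl (bounded_seq_cst nB (S x))). Qed.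
Let s_refl : seqv nB s s. Proof. exact: mapS_seqv. Qed.
Let g_refl : seqv nB g g. Proof. by apply: seqvM => //; apply: seqv_star. Qed.
Let g'_refl : seqv nB g' g'.
Proof. by apply: seqvM => //; apply: seqv_star. Qed.
Let g_star : sstar g = g. Proof. by rewrite sstarM sstarK. Qed.

Lemma unit_on_star x : unit_on x -> unit_on x^**.
Proof.
move=> [/seqv_star ex /seqv_star xe].
by split; move: ex xe; rewrite !sstarM e_star.
Qed.

Lemma unit_onD x y : unit_on x -> unit_on y -> unit_on (x + y).
Proof.
move=> [ex xe] [ey ye].
have E : cA (x + y) = cA x + cA y by [].
by split; rewrite E ?smulDr ?smulDl; apply: seqvD.
Qed.

Lemma unit_onZ (k : R[i]) x : unit_on x -> unit_on (k *: x).
Proof.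
move=> [ex xe].
have E : cA (k *: x) = k *: cA x by [].
by split; rewrite E ?smulZr ?smulZl; apply: seqvZ.
Qed.

Lemma unit_onM x y : unit_on x -> unit_on y -> unit_on (x ** y).
Proof.
move=> [ex xe] [ey ye].
have E : cA (x ** y) = cA x <*> cA y by [].
by split; rewrite E; [rewrite smulA|rewrite -smulA]; apply: seqvM.
Qed.

Let sandwich x : unit_on x -> seqv nB (s <*> sstar (sg x^**) <*> s) (sg x).
Proof.
move=> [ex xe].
have -> : s <*> sstar (sg x^**) <*> s = mapS (e <*> cA x <*> e).
  apply/funext => m; rewrite /smul /mapS /sstar /sg /s /mapS.
  by rewrite -triple_hom_quad cstarK.
apply: (@mapS_seqv _ (cA x)); apply: (seqv_trans _ xe).
by apply: seqvM.
Qed.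

Let units_sum x : unit_on x ->
  seqv nB (g <*> sg x + sg x <*> g') (sg x + sg x).
Proof.
move=> [ex xe].
have -> : g <*> sg x + sg x <*> g' =
    mapS (e <*> (e <*> cA x) + cA x <*> e <*> e).
  apply/funext => m; have := triple_hom_sym (e m) (e m) x.
  rewrite e_sa => H; rewrite -[RHS]/(S (e m ** (e m ** x) + x ** e m ** e m)).
  by rewrite cmulA H -(cmulA (S x)).
have -> : sg x + sg x = mapS (cA x + cA x).
  by apply/funext => m; rewrite /mapS linearD.
apply: mapS_seqv; apply: seqvD.
  exact: seqv_trans (seqvM e_refl ex) ex.
exact: seqv_trans (seqvM xe e_refl) xe.
Qed.

Let units_prod x : unit_on x -> seqv nB (g <*> sg x <*> g') (sg x).
Proof.
move=> ux; apply: (seqv_trans _ (sandwich ux)).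
have -> : g <*> sg x <*> g' = s <*> (sstar s <*> sg x <*> sstar s) <*> s.
  by rewrite /g /g' !smulA.
apply: seqvM => //; apply: seqvM => //.
have /seqv_star := sandwich (unit_on_star ux).
by rewrite !sstarM !sstarK cstarK smulA.
Qed.

(** With L and Q the multiplications by g on the left and g' on the right,
    L Q = 1 and L + Q = 2 give (L - 1)^2 = 0 at S x, so the square of
    g (S x) - S x vanishes. *)
Let unit_left x : unit_on x -> seqv nB (g <*> sg x) (sg x).
Proof.
move=> ux.
have ggx : seqv nB (g <*> (g <*> sg x) + sg x) (g <*> sg x + g <*> sg x).
  rewrite -smulDr; apply: (seqv_trans _ (seqvM g_refl (units_sum ux))).
  rewrite smulDr; apply: seqvD; first by do 2!apply: seqvM => //.
  by rewrite smulA; apply/seqv_sym/units_prod.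
have gx : seqv nB (g <*> sg x) (g <*> sg x) by apply: seqvM.
apply: seqv_subr0; [exact: seqv_bounded gx|exact: seqv_bounded (sg_refl x)|].
apply: seqv0_of_square.
  by apply: (@seqv_bounded _ _ _ _ (g <*> sg x - sg x)); apply: seqvB.
have -> : sstar (g <*> sg x - sg x) <*> (g <*> sg x - sg x) =
    sstar (sg x) <*> ((g <*> (g <*> sg x) + sg x) - (g <*> sg x + g <*> sg x)).
  by rewrite /g !(sstarE, smulE) !smulA; lin R[i].
have -> : 0 = sstar (sg x) <*> 0 :> (nat -> B).
  by apply/funext => m; rewrite /smul cmul0r.
by apply: seqvM; [apply: seqv_star|apply: seqv_sub0].
Qed.

Let unit_right x : unit_on x -> seqv nB (sg x <*> g') (sg x).
Proof.
move=> ux; have := seqvB (units_sum ux) (unit_left ux).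
by rewrite addrK [X in X - _]addrC addrK.
Qed.

Let unit_left_star x : unit_on x -> seqv nB (sstar (sg x) <*> g) (sstar (sg x)).
Proof. by move=> /unit_left/seqv_star; rewrite sstarM g_star. Qed.

(** Multiplication by the adjoint of s makes S an asymptotic Jordan
    *-homomorphism, see [J_star] and [J_jordan]. *)
Let J (x : A) : nat -> B := sg x <*> sstar s.

Let J_refl x : seqv nB (J x) (J x).
Proof. by apply: seqvM => //; apply: seqv_star. Qed.

Let JD x y : J (x + y) = J x + J y.
Proof.
by rewrite -smulDl; congr (_ <*> _); apply/funext => m; rewrite /sg linearD.
Qed.

Let JZ k x : J (k *: x) = k *: J x.
Proof.
by rewrite -smulZl; congr (_ <*> _); apply/funext => m; rewrite /sg linearZ.
Qed.

Let J_star x : unit_on x -> seqv nB (sstar (J x)) (J x^**).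
Proof.
move=> ux; rewrite sstarM sstarK.
apply: (@seqv_trans _ _ _ (s <*> (sstar (sg x) <*> g))).
  by apply: seqvM => //; apply/seqv_sym/unit_left_star.
rewrite /g !smulA; apply: seqvM; last exact: seqv_star.
by have := sandwich (unit_on_star ux); rewrite cstarK.
Qed.

Let sg_mul_star x y : unit_on x -> unit_on y ->
  seqv nB (sg x <*> sstar (sg y)) (J x <*> J y^**).
Proof.
move=> ux uy; apply: (@seqv_trans _ _ _ (sg x <*> g' <*> sstar (sg y))).
  by apply: seqvM; [exact/seqv_sym/unit_right|exact: seqv_star].
have -> : sg x <*> g' <*> sstar (sg y) = J x <*> sstar (J y).
  by rewrite /J /g' sstarM sstarK !smulA.
by apply: seqvM => //; apply: J_star.
Qed.

Let J_jordan x y : unit_on x -> unit_on y ->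
  seqv nB (J x <*> J y + J y <*> J x) (J (x ** y) + J (y ** x)).
Proof.
move=> [ex xe] [ey ye]; rewrite /J !smulA -!smulDl.
apply: seqvM; last exact: seqv_star.
have -> : sg x <*> sstar s <*> sg y + sg y <*> sstar s <*> sg x =
    mapS (cA x <*> e <*> cA y + cA y <*> e <*> cA x).
  apply/funext => m; have := triple_hom_sym x (e m) y.
  by rewrite e_sa.
have -> : sg (x ** y) + sg (y ** x) = mapS (cA x <*> cA y + cA y <*> cA x).
  by apply/funext => m; rewrite /mapS linearD.
by apply: mapS_seqv; apply: seqvD; apply: seqvM.
Qed.

(** Asymptotically J x (J x^** ) - J (x x^** ), by [defect_mult], but exactly
    self-adjoint. *)
Let defect (x : A) : nat -> B := sg x <*> sstar (sg x)
  - (2%:R^-1)%:C *: (J (x ** x^**) + sstar (J (x ** x^**))).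

Let defect_sa x m : (defect x m)^** = defect x m.
Proof.
rewrite -[LHS]/(sstar (defect x) m); congr (_ m).
rewrite /defect sstarD sstarN sstarZ conjc_real sstarD sstarK sstarM sstarK.
by rewrite [sstar (J _) + _]addrC.
Qed.

Let unit_on_square x : unit_on x -> unit_on (x ** x^**).
Proof. by move=> ux; apply/unit_onM/unit_on_star. Qed.

Let J_square_sa x : unit_on x ->
  seqv nB (sstar (J (x ** x^**))) (J (x ** x^**)).
Proof.
by move=> /unit_on_square/J_star; rewrite cstarM cstarK.
Qed.

Let defect_mult x : unit_on x ->
  seqv nB (defect x) (J x <*> J x^** - J (x ** x^**)).
Proof.
move=> ux; apply: seqvB; first exact: sg_mul_star.
rewrite [X in seqv _ _ X](_ : _ =
    (2%:R^-1)%:C *: (J (x ** x^**) + J (x ** x^**))); last first.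
  by rewrite fmorphV rmorph_nat; lin R[i].
by apply/seqvZ/seqvD => //; apply: J_square_sa.
Qed.

Let defect_star x : unit_on x -> seqv nB (defect x + defect x^**) 0.
Proof.
move=> ux; have ux' := unit_on_star ux.
apply: (seqv_trans (seqvD (defect_mult ux) (defect_mult ux'))).
rewrite cstarK.
have -> : J x <*> J x^** - J (x ** x^**) + (J x^** <*> J x - J (x^** ** x)) =
  (J x <*> J x^** + J x^** <*> J x) - (J (x ** x^**) + J (x^** ** x)).
  by lin R[i].
exact/seqv_sub0/J_jordan.
Qed.

Let defect_unit x : unit_on x -> seqv nB (g <*> defect x) (defect x).
Proof.
move=> ux; have uxx := unit_on_square ux.
have unitJ y : unit_on y -> seqv nB (g <*> J y) (J y).
  move=> uy; rewrite smulA.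
  by apply: seqvM; [exact: unit_left|exact: seqv_star].
have dM := defect_mult ux.
apply: (seqv_trans _ (seqv_sym dM)).
apply: (seqv_trans (seqvM g_refl dM)).
rewrite !smulE smulA; apply: seqvB; last exact: unitJ.
by apply: seqvM => //; apply: unitJ.
Qed.

(** The row (e (1 - t p / 2), sqrt t e x), with p = x x^**, is e times the first
    row of an approximately unitary two by two matrix. *)
Let defect_row x : unit_on x -> exists2 C : R, 0 <= C &
  forall t : R, 0 < t -> \forall m \near \oo%classic,
    nB (g m + t%:C *: defect x m) <= 1 + C * t ^+ 2.
Proof.
move=> ux; pose p := x ** x^**; have up : unit_on p := unit_on_square ux.
have p_sa : p^** = p by rewrite cstarM cstarK.
pose P := nA p; exists (P ^+ 2 / 2 + 1).
  by rewrite addr_ge0 // divr_ge0 // sqr_ge0.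
move=> t t0; pose r := Num.sqrt t; pose h := (t / 2)%:C.
have rr : r%:C * r%:C = t%:C by rewrite -rmorphM -expr2 sqr_sqrtr ?ltW.
have hE : h = t%:C / 2 by rewrite /h rmorphM fmorphV rmorph_nat.
have hhE : (t ^+ 2 / 4)%:C = h * h :> R[i].
  by rewrite -rmorphM; congr (_%:C); field.
have hc : conjc h = h by exact: conjc_real.
clearbody h.
pose X1 := e - h *: (e <*> cA p); pose X2 := r%:C *: (e <*> cA x).
have rowE : X1 <*> sstar X1 + X2 <*> sstar X2 =
    e <*> e + (t ^+ 2 / 4)%:C *: (e <*> (cA p <*> cA p) <*> e).
  have pE : cA p = cA x <*> sstar (cA x) by [].
  rewrite hhE /X1 /X2 pE !(sstarE, smulE) e_star !(hc, conjc_real).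
  by rewrite !smulA hE -rr; lin R[i].
pose Z := mapS X1 <*> sstar (mapS X1) + mapS X2 <*> sstar (mapS X2).
have t4_ge0 : 0 <= t ^+ 2 / 4 by rewrite divr_ge0 // sqr_ge0.
have Z_le m : nB (Z m) <= 1 + t ^+ 2 / 4 * P ^+ 2.
  apply: le_trans (S_row _ _) _.
  rewrite -[X in nA X]/((X1 <*> sstar X1 + X2 <*> sstar X2) m) rowE.
  apply: nmD_le; first by rewrite -[1]mulr1; apply: nmM_le.
  rewrite -[X in nA X]/((t ^+ 2 / 4)%:C *: (e m ** (p ** p) ** e m)).
  rewrite nmZr // ler_wpM2l // -[P ^+ 2]mulr1 -[P ^+ 2]mul1r expr2.
  by apply: nmM_le => //; apply: nmM_le => //; apply: nmM_le.
pose Y1 := s - h *: sg p; pose Y2 := r%:C *: sg x.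
have XY1 : seqv nB (mapS X1) Y1.
  have -> : Y1 = mapS (e - h *: cA p).
    by apply/funext => m; rewrite /mapS linearB linearZ.
  by apply/mapS_seqv/seqvB => //; apply: seqvZ; case: up.
have XY2 : seqv nB (mapS X2) Y2.
  have -> : Y2 = mapS (r%:C *: cA x).
    by apply/funext => m; rewrite /mapS linearZ.
  by apply/mapS_seqv/seqvZ; case: ux.
have YE : Y1 <*> sstar Y1 + Y2 <*> sstar Y2 =
    g + t%:C *: defect x + (t ^+ 2 / 4)%:C *: (sg p <*> sstar (sg p)).
  rewrite hhE /Y1 /Y2 /defect -/p /J !(sstarE, smulE) !(hc, conjc_real) /g.
  have -> : (2%:R^-1)%:C = 2^-1 :> R[i] by rewrite fmorphV rmorph_nat.
  by rewrite hE -rr; lin R[i].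
have [_ _ ZY] : seqv nB Z (Y1 <*> sstar Y1 + Y2 <*> sstar Y2).
  by apply: seqvD; apply: seqvM => //; apply: seqv_star.
apply: filterS (ZY _ (exprn_gt0 2 t0)) => m ZYm.
have -> : g m + t%:C *: defect x m =
    Z m - (Z - (Y1 <*> sstar Y1 + Y2 <*> sstar Y2)) m
    - (t ^+ 2 / 4)%:C *: (S p ** (S p)^**).
  rewrite -[X in Z m - X]/(Z m - (Y1 <*> sstar Y1 + Y2 <*> sstar Y2) m) YE.
  rewrite -[X in Z m - (Z m - X)]/(g m + t%:C *: defect x m +
    (t ^+ 2 / 4)%:C *: (S p ** (S p)^**)).
  by lin R[i].
apply: le_trans (nmB _ _ _) _.
apply: le_trans (lerD (le_trans (nmB _ _ _) (lerD (Z_le m) ZYm)) (lexx _)) _.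
rewrite nmZr // nmCr.
have : nB (S p) ^+ 2 <= P ^+ 2.
  by rewrite ler_sqr ?nnegrE ?nm_ge0 // row_contractive.
move/(ler_wpM2l t4_ge0); lra.
Qed.

Lemma bernoulli_inv (y : R) N : 0 <= y -> N%:R * y <= 2^-1 -> (1 + y) ^+ N <= 2.
Proof.
move=> y0 Ny; have : (1 + y) ^+ N * (1 - N%:R * y) <= 1.
  elim: N {Ny} => [|N IH]; first by rewrite expr0 mul0r subr0 mul1r.
  apply: le_trans IH; rewrite exprSr -mulrA ler_wpM2l ?exprn_ge0 ?addr_ge0 //.
  rewrite -natr1; have : 0 <= N%:R * y * y by rewrite !mulr_ge0.
  by have := sqr_ge0 y; lra.
have : 0 <= (1 + y) ^+ N by rewrite exprn_ge0 ?addr_ge0.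
set Y := (1 + y) ^+ N; set z := N%:R * y in Ny *.
by nra.
Qed.

(** [defect_row] at x and at x^** provides the two norm bounds of
    [rigidity_bound], since the defects at x and x^** are opposite. *)
Let defect_null x : unit_on x -> seqv nB (defect x) 0.
Proof.
move=> ux; have ux' := unit_on_star ux.
have [C1 C1_ge0 row1] := defect_row ux.
have [C2 C2_ge0 row2] := defect_row ux'.
have [K K_gt0 K_le] : exists2 K : R, 0 < K & forall m, nB (defect x m) <= K.
  by apply: bounded_seq_pos; case: (defect_mult ux).
split; [by case: (defect_mult ux)|exact: (bounded_seq_cst nB 0)|].
(* If the defect k were larger than eps, then T k^2 > 4 k, whereas
   [rigidity_bound] gives T k^2 <= 2 (k + eps). *)
move=> eps eps0; pose T := 4 / eps; have T0 : 0 < T by rewrite divr_gt0.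
pose C := C1 + C2 + 1; pose D := C + 1 + K ^+ 2.
have C_ge0 : 0 <= C by rewrite /C; lra.
have D_gt0 : 0 < D by rewrite /D; have := sqr_ge0 K; lra.
have X_ge0 : 0 <= 2 * D * T ^+ 2.
  by rewrite pmulr_lge0 ?exprn_gt0 // mulr_ge0 // ltW.
(* N is large enough for (1 + D t^2)^N <= 2, where t = T / N. *)
have [N N_big] : exists N : nat, 2 * D * T ^+ 2 < N%:R.
  by exists (Num.bound (2 * D * T ^+ 2)); apply: archi_boundP.
have NR0 : 0 < N%:R :> R by apply: le_lt_trans N_big.
have N0 : (0 < N)%N by rewrite -(ltr_nat R).
pose t := T / N%:R; have t0 : 0 < t by rewrite divr_gt0.
have Nt : N%:R * t = T by rewrite mulrC divfK // gt_eqF.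
have half_Nt : 0 < t / 2 by rewrite divr_gt0.
pose Q := (1 + t * K) ^+ N.
have Q0 : 0 < Q by rewrite exprn_gt0 // ltr_wpDr // mulr_ge0 ?ltW.
have eta0 : 0 < eps / (N%:R * Q) by rewrite divr_gt0 // mulr_gt0.
have [_ _ dstar] := defect_star ux.
have [_ _ dunit] := defect_unit ux.
near=> m; rewrite subr0.
have r1 : nB (g m + t%:C *: defect x m) <= 1 + C1 * t ^+ 2.
  by near: m; apply: row1.
have r2 : nB (g m + t%:C *: defect x^** m) <= 1 + C2 * t ^+ 2.
  by near: m; apply: row2.
have sum_le : nB (defect x m + defect x^** m) <= t.
  by near: m; apply: filterS (dstar _ t0) => m; rewrite subr0.
have d_le1 : nB (g m ** defect x m - defect x m) <= t / 2.
  by near: m; apply: dunit.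
have d_le2 : nB (g m ** defect x m - defect x m) <= eps / (N%:R * Q).
  by near: m; apply: dunit.
have Km := K_le m.
have g_sa : (g m)^** = g m by rewrite -[LHS]/(sstar g m) g_star.
have tt_ge0 : 0 <= t ^+ 2 := sqr_ge0 t.
have r3 : nB (g m - t%:C *: defect x m) <= 1 + C * t ^+ 2.
  have -> : g m - t%:C *: defect x m = (g m + t%:C *: defect x^** m)
      - t%:C *: (defect x m + defect x^** m) by lin R[i].
  apply: le_trans (nmB _ _ _) _; rewrite nmZr ?(ltW t0) //.
  have := ler_wpM2l (ltW t0) sum_le; rewrite -expr2.
  by have := mulr_ge0 C1_ge0 tt_ge0; move: r2; rewrite /C; lra.
have r4 : nB (g m + t%:C *: defect x m) <= 1 + C * t ^+ 2.
  by have := mulr_ge0 C2_ge0 tt_ge0; move: r1; rewrite /C; lra.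
have y'_ge0 : 0 <= D * t ^+ 2 by rewrite mulr_ge0 // ltW.
have k0 := nm_ge0 nB (defect x m).
have := rigidity_bound g_sa (defect_sa x m) (ltW t0) N0 y'_ge0 r4 r3.
set d := nB (_ - _) in d_le1 d_le2 *; set k := nB (defect x m) in Km k0 *.
have d0 : 0 <= d := nm_ge0 _ _.
have kK : k ^+ 2 <= K ^+ 2 by rewrite ler_sqr ?nnegrE // ltW.
have -> : (1 + C * t ^+ 2) ^+ 2 + 2 * t * d + t ^+ 2 * k ^+ 2
    <= (1 + D * t ^+ 2) ^+ 2.
  have td : t * d <= t * (t / 2) by rewrite ler_wpM2l // ltW.
  have tk := ler_wpM2l tt_ge0 kK.
  have CD : C * t ^+ 2 <= D * t ^+ 2.
    by rewrite ler_wpM2r // /D; have := sqr_ge0 K; lra.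
  have CD2 : (C * t ^+ 2) ^+ 2 <= (D * t ^+ 2) ^+ 2.
    by rewrite ler_sqr ?nnegrE //; apply: mulr_ge0.
  have tK : 0 <= t ^+ 2 * K ^+ 2 by rewrite mulr_ge0 // sqr_ge0.
  by move: td tk CD2 tK; rewrite /D; lra.
move=> /(_ isT); rewrite Nt => bound.
have Y2 : (1 + D * t ^+ 2) ^+ N <= 2.
  apply: bernoulli_inv => //.
  have -> : N%:R * (D * t ^+ 2) = D * T ^+ 2 / N%:R.
    by rewrite -Nt; field; rewrite gt_eqF.
  by rewrite ler_pdivrMr //; lra.
have QQ : (1 + t * k) ^+ N <= Q.
  apply: lerXn2r; last by rewrite lerD2l ler_wpM2l // ltW.
    by rewrite nnegrE addr_ge0 // mulr_ge0 // ltW.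
  by rewrite nnegrE addr_ge0 // mulr_ge0 // ltW.
have dQ : N%:R * d * (1 + t * k) ^+ N <= eps.
  apply: (@le_trans _ _ (N%:R * d * Q)); first by rewrite ler_wpM2l // mulr_ge0.
  by move: d_le2; rewrite ler_pdivlMr ?mulr_gt0 //; lra.
have {}bound : T * k ^+ 2 <= 2 * (k + eps).
  apply: le_trans bound _; apply: ler_pM => //.
  - by rewrite exprn_ge0 // addr_ge0.
  - apply: addr_ge0 => //; apply: mulr_ge0; first by rewrite mulr_ge0 // ltW.
    by rewrite exprn_ge0 // addr_ge0 // mulr_ge0 // ltW.
  - by rewrite lerD2l.
rewrite leNgt; apply/negP => eps_k.
have : T * k ^+ 2 * eps = 4 * k ^+ 2 by rewrite /T; field; rewrite gt_eqF.
have := ler_wpM2r (ltW eps0) bound.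
by nra.
Unshelve. all: by end_near.
Qed.

(** Polarization: the defects at x + y^** and at x + i y^** give the sum and the
    difference of the failures of multiplicativity at the pairs (x, y) and
    (y^**, x^** ). *)
Let J_mult x y : unit_on x -> unit_on y -> seqv nB (J x <*> J y) (J (x ** y)).
Proof.
pose f a b := J a <*> J b - J (a ** b).
have f0 z : unit_on z -> seqv nB (f z z^**) 0.
  move=> uz; apply: (seqv_trans _ (defect_null uz)).
  exact/seqv_sym/defect_mult.
have f_bdd a b : bounded_seq nB (f a b).
  by apply: (@seqv_bounded _ _ _ _ (f a b)); apply: seqvB => //; apply: seqvM.
move=> ux uy; have uy' := unit_on_star uy.
pose I : R[i] := 'i%C; have II : I * I = -1 by exact: sqr_i.
have I_neq0 : I != 0 by rewrite eq_complex /= oner_eq0 andbF.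
have Ic : conjc I = I^-1.
  apply: (mulfI I_neq0); rewrite divff // /I; apply/eqP; rewrite eq_complex /=.
  by apply/andP; split; apply/eqP; ring.
clearbody I.
have f1 := f0 _ (unit_onD ux uy').
have f2 := f0 _ (unit_onD ux (unit_onZ I uy')).
have F1 := seqvB (seqvB f1 (f0 _ ux)) (f0 _ uy').
have F2 := seqvB (seqvB f2 (f0 _ ux)) (f0 _ uy').
apply: seqv_subr0; [by case: (seqvM (J_refl x) (J_refl y))| |].
  by case: (J_refl (x ** y)).
pose beta := (I^-1 - I)^-1.
have := seqvD (seqvZ (- beta * I) F1) (seqvZ beta F2).
rewrite !subr0 !scaler0 addr0; congr seqv.
rewrite /beta /f !(cstarE, Ic) !cmulE !(JD, JZ) !smulE.
have side : (I != 0) && (1 + - I * I != 0).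
  by rewrite I_neq0 mulNr II opprK -[_ + 1](natrD _ 1 1) pnatr_eq0.
by lin R[i].
Qed.

Lemma tro_on_units a b c : unit_on a -> unit_on b -> unit_on c ->
  S (a ** b^** ** c) = S a ** (S b)^** ** S c.
Proof.
move=> ua ub uc; apply: (@seqv_cst_eq _ _ nB); rewrite -/(sg _).
have uabc : unit_on (a ** b^** ** c).
  by apply: unit_onM => //; apply: unit_onM => //; apply: unit_on_star.
pose V := sg a <*> sstar (sg b) <*> sg c; rewrite -[X in seqv _ _ X]/V.
apply: (@seqv_trans _ _ _ (J (a ** b^** ** c) <*> s)).
  by rewrite /J -smulA; apply/seqv_sym/unit_right.
apply: (@seqv_trans _ _ _ (V <*> sstar s <*> s)); last first.
  rewrite -smulA /V -smulA; apply: seqvM; last exact: unit_right.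
  by apply: seqvM => //; apply: seqv_star.
apply: seqvM => //; apply: seqv_sym; rewrite /V -smulA -/(J c).
have uab : unit_on (a ** b^**) by apply: unit_onM => //; apply: unit_on_star.
apply: (seqv_trans _ (J_mult uab uc)); apply: seqvM => //.
apply: seqv_trans (sg_mul_star ua ub) _.
by apply: J_mult => //; apply: unit_on_star.
Qed.

End LocalUnit.
End TripleHom.

(** * Common approximate units and the theorem *)

Section LocalUnits.
Context {R : realType} {A : cstarAlgType R} (n : cnorm A).
Context (n_col : forall x y, n y ^+ 2 <= n (y^** ** y + x^** ** x)).

(** With u = 1 - e, the column (y u, z u) has square u h u. *)
Lemma dominated_unit (e y z h : A) : e^** = e -> n e <= 1 ->
  y^** ** y + z^** ** z = h ->
  n (y - y ** e) ^+ 2 <= 2 * n (h - h ** e).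
Proof.
move=> e_sa e1 hE; apply: le_trans (n_col (z - z ** e) _) _.
have -> : (y - y ** e)^** ** (y - y ** e) + (z - z ** e)^** ** (z - z ** e) =
    (h - h ** e) - e ** (h - h ** e).
  by rewrite -hE !(cstarE, cmulE) e_sa !cmulA; lin R[i].
apply: le_trans (nmB _ _ _) _.
have := nmM_le e1 (lexx (n (h - h ** e))); lra.
Qed.

(** Only sums of two squares are monotone here, hence the nesting
    h = a^2 + (b^2 + c^2)^2: an approximate unit for h is one for a and for
    v = b^2 + c^2, and one for v is one for b and c. *)
Lemma common_unit (a b c : A) (eps : R) :
  a^** = a -> b^** = b -> c^** = c -> 0 < eps ->
  exists e, [/\ e^** = e, n e <= 1 & [/\ n (a - a ** e) <= eps,
    n (b - b ** e) <= eps & n (c - c ** e) <= eps]].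
Proof.
move=> a_sa b_sa c_sa eps0; pose v := b ** b + c ** c.
have v_sa : v^** = v by rewrite /v !cstarE b_sa c_sa.
have vE : b ** b + c ** c = v by [].
clearbody v.
have h_sa : (a ** a + v ** v)^** = a ** a + v ** v.
  by rewrite !cstarE a_sa v_sa.
pose u := eps ^+ 2; have u0 : 0 < u by rewrite exprn_gt0.
(* Small enough for both 2 d <= u and 2 d <= (u / 2)^2. *)
pose d := u ^+ 2 / (8 * (1 + u)).
have d0 : 0 < d by rewrite divr_gt0 ?exprn_gt0 // mulr_gt0 // addr_gt0.
have dE : d * (8 * (1 + u)) = u ^+ 2.
  by rewrite divfK // gt_eqF // mulr_gt0 // addr_gt0.
have d_le : d <= u / 8.
  by rewrite ler_pdivrMr ?mulr_gt0 ?addr_gt0 //; lra.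
have ud := mulr_gt0 u0 d0.
have [e [e_sa e1 he]] := approx_unit n h_sa d0.
exists e; split=> //.
have le_eps x : n x ^+ 2 <= u -> n x <= eps.
  by rewrite ler_sqr // nnegrE ?nm_ge0 // ltW.
have va : n (v - v ** e) <= u / 2.
  rewrite -ler_sqr ?nnegrE ?nm_ge0 ?divr_ge0 ?(ltW u0) //.
  have := @dominated_unit e v a (a ** a + v ** v) e_sa e1.
  rewrite a_sa v_sa addrC => /(_ erefl) /le_trans; apply.
  by rewrite expr_div_n; lra.
split; apply: le_eps.
- have := @dominated_unit e a v (a ** a + v ** v) e_sa e1.
  by rewrite a_sa v_sa => /(_ erefl) /le_trans; apply; lra.
- have := @dominated_unit e b c v e_sa e1.
  by rewrite b_sa c_sa => /(_ vE) /le_trans; apply; lra.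
- have := @dominated_unit e c b v e_sa e1.
  by rewrite b_sa c_sa addrC => /(_ vE) /le_trans; apply; lra.
Qed.

Lemma common_unit_seq (a b c : A) : a^** = a -> b^** = b -> c^** = c ->
  exists e : nat -> A, [/\ forall m, (e m)^** = e m, forall m, n (e m) <= 1 &
    [/\ unit_on n e a, unit_on n e b & unit_on n e c]].
Proof.
move=> a_sa b_sa c_sa.
have inv0 m : 0 < m.+1%:R^-1 :> R by rewrite invr_gt0.
have /choice[e eP] m := common_unit a_sa b_sa c_sa (inv0 m).
exists e; split; try by move=> m; case: (eP m).
have unit x : x^** = x -> (forall m, n (x - x ** e m) <= m.+1%:R^-1) ->
    unit_on n e x.
  move=> x_sa xe.
  have eb : bounded_seq n e by exists 1 => m; case: (eP m).
  have xb := bounded_seq_cst n x.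
  have xe0 : seqv n (smul (fun=> x) e) (fun=> x).
    split=> //; first exact: bounded_seqM.
    move=> eps eps0; have [M _ MP] := near_infty_natSinv_lt (PosNum eps0).
    exists M => // m Mm; rewrite [X in n X](_ : _ = x ** e m - x) // nmBC.
    exact: le_trans (xe m) (ltW (MP _ Mm)).
  split=> //; have := seqv_star xe0; rewrite sstarM.
  rewrite [sstar (fun=> x)](_ : _ = fun=> x); last exact/funext.
  by rewrite [sstar e](_ : _ = e) //; apply/funext => m; case: (eP m).
by split; apply: unit => // m; case: (eP m) => _ _ [].
Qed.

End LocalUnits.

(** Self-adjoint elements span A.  The scalar twist c allows f to be conjugate
    linear. *)
Lemma sa_span (R : realType) (A B : cstarAlgType R) (f : A -> B)
  (c : R[i] -> R[i]) :
  {morph f : x y / x + y} -> (forall k x, f (k *: x) = c k *: f x) ->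
  (forall x, x^** = x -> f x = 0) -> forall x, f x = 0.
Proof.
move=> fD fZ f0 x; pose I : R[i] := 'i%C.
have II : I * I = -1 by exact: sqr_i.
have Ic : conjc I = - I.
  by apply/eqP; rewrite eq_complex /= oppr0 !eqxx.
clearbody I.
have half_c : conjc (2^-1 : R[i]) = 2^-1 by rewrite conjc_inv conjc_nat.
pose a := 2^-1 *: (x + x^**); pose b := (2^-1 * I) *: (x^** - x).
have a_sa : a^** = a by rewrite /a !cstarE half_c addrC.
have b_sa : b^** = b.
  by rewrite /b !cstarE conjcM half_c Ic; lin R[i].
have -> : x = a + I *: b.
  by rewrite /a /b scalerA mulrCA II; lin R[i].
by rewrite fD (fZ I b) (f0 a a_sa) (f0 b b_sa) scaler0 addr0.
Qed.

Theorem corollary9 (R : realType) (A B : cstarAlgType R)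
    (S : {linear A -> B}) :
  two_contractive S -> triple_hom S -> tro_hom S.
Proof.
move=> [MA [MB [phi [psi [phi_M2 psi_M2 S_contr]]]]] S_triple.
have S_row x y : corner psi_M2 (S x ** (S x)^** + S y ** (S y)^**) <=
    corner phi_M2 (x ** x^** + y ** y^**).
  rewrite -!corner_row ler_sqr ?nnegrE ?rnorm_ge0 //.
  rewrite -lecR !rnormE; have := S_contr (mx4 x y 0 0).
  by rewrite mx4_map !linear0.
have tro_sa a b c : a^** = a -> b^** = b -> c^** = c ->
    S (a ** b^** ** c) - S a ** (S b)^** ** S c = 0.
  move=> a_sa b_sa c_sa.
  have [e [e_sa e1 [ua ub uc]]] :=
    common_unit_seq (corner_col phi_M2) a_sa b_sa c_sa.
  by rewrite (tro_on_units S_triple S_row e_sa e1 ua ub uc) subrr.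
have SZ k u : S (k *: u) = k *: S u by exact: linearZZ.
move=> a b c; apply/eqP; rewrite -subr_eq0; apply/eqP; move: c.
apply: (@sa_span _ _ _ _ (fun k => k)) => [x y|k x|c c_sa].
- by rewrite linearD !cmulE linearD; lin R[i].
- by rewrite SZ !cmulE SZ /=; lin R[i].
move: b; apply: (@sa_span _ _ _ _ conjc) => [x y|k x|b b_sa].
- by rewrite linearD !(cstarE, cmulE) linearD; lin R[i].
- by rewrite SZ !(cstarE, cmulE) SZ /=; lin R[i].
move: a; apply: (@sa_span _ _ _ _ (fun k => k)) => [x y|k x|a a_sa].
- by rewrite linearD !cmulE linearD; lin R[i].
- by rewrite SZ !cmulE SZ /=; lin R[i].
exact: tro_sa.
Qed.
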